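(* Let $G$ be a resource contribution game with endowments as bags of atomic resources (RCGBAR). Then the set $\mathsf{NE}^{\mathsf{pca}}(G)$ of pure Nash equilibria of $G$ according to public contention-averse preferences is non-empty, and finding a profile in it (given $G$ as input) can be done in polynomial time.
   Context: Resources. Let $Res$ be a set of atomic resource types. A resource bundle is a finite multiset over $Res$; $A_1\bullet\cdots\bullet A_k$ is the bundle consisting of the instances $A_1,\dots,A_k$, and $B\bullet B'$ is the multiset sum of bundles $B,B'$. For a bundle $B$, $\flat(B)$ is its multiset of atomic resource instances. A resource bag is a finite multiset of resource bundles; for a bag $X=\{B_1,\dots,B_k\}$, $\flat^\bullet(X)=\flat(B_1)\uplus\dots\uplus\flat(B_k)$ (multiset sum). A bag $X$ can be transformed into a bundle $B$, written $X\rightsquigarrow B$, iff $\flat(B)\subseteq\flat^\bullet(X)$ (multiset inclusion). Games. A resource contribution game (RCG) is $G=(N,\gamma_1,\dots,\gamma_n,\epsilon_1,\dots,\epsilon_n)$ with $N=\{1,\dots,n\}$ a finite set of players, $\gamma_i$ a resource bundle (goal of $i$), $\epsilon_i$ a finite resource bag (endowment of $i$). It is an RCGBAR iff for every $i\in N$ every element of $\epsilon_i$ is an atomic resource (a bundle consisting of a single instance of an element of $Res$). The choices of $i$ are $\mathsf{ch}_i(G)=\{C\mid C\subseteq\epsilon_i\}$ (sub-multisets), the profiles are $\mathsf{ch}(G)=\prod_{i\in N}\mathsf{ch}_i(G)$, and the outcome of $P=(P_1,\dots,P_n)$ is the bag $\mathsf{out}(P)=P_1\uplus\dots\uplus P_n$.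 $(P_{-i},P_i')$ is $P$ with $P_i$ replaced by $P'_i$. Satisfaction and contention. Player $i$ is potentially satisfied in $P$ iff $\mathsf{out}(P)\rightsquigarrow\gamma_i$. Let $\{s_1,\dots,s_k\}$ be the set of players potentially satisfied in $P$. $P$ is contentious iff $\mathsf{out}(P)\not\rightsquigarrow\gamma_{s_1}\bullet\dots\bullet\gamma_{s_k}$. Preferences. $P$ is good for $i$ according to $\mathsf{pca}$ (public contention-averse) iff $i$ is potentially satisfied in $P$ and $P$ is not contentious. Player $i$ strictly prefers $P$ over $Q$ (written $Q\prec_i^{\mathsf{pca}}P$) iff one of: (1) neither $P$ nor $Q$ is good for $i$ and $P_i\subset Q_i$ (strict multiset inclusion); (2) $P$ is good for $i$ and $Q$ is not; (3) both are good for $i$ and $P_i\subset Q_i$. $P$ is a (pure) Nash equilibrium according to $\mathsf{pca}$ iff there are no $i\in N$ and $P'_i\in\mathsf{ch}_i(G)$ with $P\prec_i^{\mathsf{pca}}(P_{-i},P'_i)$; $\mathsf{NE}^{\mathsf{pca}}(G)$ is the set of these. Encoding. Multisets are given by listing their elements with repetition; the atomic resource types are part of the input. *)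

(* Defs.v *)
From HB Require Import structures.
From mathcomp Require Import all_boot all_order all_algebra.
From mathcomp Require Import finmap multiset.

Set Implicit Arguments.
Unset Strict Implicit.
Unset Printing Implicit Defensive.

Local Open Scope mset_scope.

Section Games.

Variable Res : choiceType.

Local Notation bundle := {mset Res}.
Local Notation bag := {mset {mset Res}}.

(* A bundle is already the multiset of its atomic instances, so flattening
   is the identity on bundles and the multiset sum on bags. *)
Definition flat_bag (X : bag) : bundle := \big[msetD/mset0]_(B <- X) B.

Definition transforms (X : bag) (B : bundle) : bool := B `<=` flat_bag X.

Record rcg := RCG {
  nplayers : nat;
  goal : 'I_nplayers -> bundle;
  endowment : 'I_nplayers -> bag
}.

Definition rcgbar (G : rcg) : Prop :=
  forall (i : 'I_(nplayers G)) (B : bundle),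
    B \in endowment i -> exists a : Res, B = [mset a].

Variable G : rcg.

Local Notation player := 'I_(nplayers G).

(* Arbitrary families of bags; those that belong to ch(G) are singled out by
   [is_profile]. *)
Definition profile : Type := {ffun player -> bag}.

Definition is_choice (i : player) (C : bag) : bool := C `<=` endowment i.

Definition is_profile (P : profile) : Prop := forall i, is_choice i (P i).

Definition outcome (P : profile) : bag := \big[msetD/mset0]_(i < nplayers G) P i.

Definition deviate (P : profile) (i : player) (C : bag) : profile :=
  [ffun j => if j == i then C else P j].

Definition pot_satisfied (P : profile) (i : player) : bool :=
  transforms (outcome P) (goal i).

Definition contentious (P : profile) : bool :=
  ~~ transforms (outcome P)
       (\big[msetD/mset0]_(i < nplayers G | pot_satisfied P i) goal i).

Definition good_pca (i : player) (P : profile) : bool :=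
  pot_satisfied P i && ~~ contentious P.

(* [prefers_pca i P Q]: player [i] strictly prefers [P] over [Q]. *)
Definition prefers_pca (i : player) (P Q : profile) : bool :=
  [|| [&& ~~ good_pca i P, ~~ good_pca i Q & P i `<` Q i],
      good_pca i P && ~~ good_pca i Q
    | [&& good_pca i P, good_pca i Q & P i `<` Q i]].

Definition NE_pca (P : profile) : Prop :=
  is_profile P /\
  ~ (exists (i : player) (C : bag),
       is_choice i C /\ prefers_pca i (deviate P i C) P).

End Games.

(* Deterministic multi-tape Turing machines over the input/output alphabet
   [S].  There are [tm_k.+1] two-way infinite tapes; a cell is blank ([None])
   or holds an input/output symbol ([inl]) or an auxiliary symbol ([inr]). *)

Inductive move := MoveL | MoveN | MoveR.

Record tm (S : finType) := TM {
  tm_k : nat;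
  tm_aux : finType;
  tm_state : finType;
  tm_start : tm_state;
  (* [None] means that the machine halts. *)
  tm_trans : tm_state -> {ffun 'I_tm_k.+1 -> option (S + tm_aux)} ->
    option (tm_state * ('I_tm_k.+1 -> option (S + tm_aux) * move))
}.

(* The scanned cell, and the cells on its left and on its right, the nearest
   one first; all the cells that are not listed are blank. *)
Record tape (A : Type) := Tape {
  tape_left : seq (option A);
  tape_cur : option A;
  tape_right : seq (option A)
}.

Definition blank_tape (A : Type) : tape A := Tape [::] None [::].

Definition tape_write (A : Type) (c : option A) (t : tape A) : tape A :=
  Tape (tape_left t) c (tape_right t).

Definition tape_move (A : Type) (m : move) (t : tape A) : tape A :=
  let: Tape l c r := t in
  match m with
  | MoveL => Tape (behead l) (head None l) (c :: r)
  | MoveN => t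
  | MoveR => Tape (c :: l) (head None r) (behead r)
  end.

Section Run.

Variables (S : finType) (M : tm S).

Local Notation cell := (option (S + tm_aux M)).

Definition tm_config : Type :=
  (tm_state M * ('I_(tm_k M).+1 -> tape (S + tm_aux M)))%type.

Definition tm_step (c : tm_config) : option tm_config :=
  let: (q, ts) := c in
  if tm_trans q [ffun k => tape_cur (ts k)] is Some (q', act) then
    Some (q', fun k => tape_move (act k).2 (tape_write (act k).1 (ts k)))
  else None.

Fixpoint tm_steps (t : nat) (c : tm_config) : option tm_config :=
  if t is t'.+1 then obind (tm_steps t') (tm_step c) else Some c.

Definition input_tape (w : seq S) : tape (S + tm_aux M) :=
  let cells : seq cell := [seq Some (inl a) | a <- w] in
  Tape [::] (head None cells) (behead cells).

(* The input word is on the first tape, with its first symbol scanned. *)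
Definition tm_init (w : seq S) : tm_config :=
  (tm_start M, fun k => if k == ord0 then input_tape w else blank_tape _).

Fixpoint leading_word (s : seq cell) : seq S :=
  if s is Some (inl a) :: s' then a :: leading_word s' else [::].

(* The output word is read on the last tape, from the scanned cell rightwards
   up to the first cell that does not hold an input/output symbol. *)
Definition tm_output (c : tm_config) : seq S :=
  let t := c.2 ord_max in leading_word (tape_cur t :: tape_right t).

Definition tm_computes (w : seq S) (t : nat) (v : seq S) : Prop :=
  exists c : tm_config,
    [/\ tm_steps t (tm_init w) = Some c, tm_step c = None & tm_output c = v].

End Run.

Inductive symbol := Bit of bool | Open | Close.

Definition symbol_code (a : symbol) : option (option bool) :=
  match a with Bit b => Some (Some b) | Open => Some None | Close => None end.

Definition symbol_decode (x : option (option bool)) : symbol :=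
  match x with Some (Some b) => Bit b | Some None => Open | None => Close end.

Lemma symbol_codeK : cancel symbol_code symbol_decode.
Proof. by case. Qed.

HB.instance Definition _ := Finite.copy symbol (can_type symbol_codeK).

Definition enc_list (s : seq (seq symbol)) : seq symbol :=
  Open :: flatten s ++ [:: Close].

(* Resource types are finitely many, and each is written as the bit string
   [name a] at every occurrence. *)
Section Encoding.

Variables (Res : finType) (name : Res -> seq bool).

Definition enc_res (a : Res) : seq symbol :=
  enc_list [seq [:: Bit b] | b <- name a].

Definition enc_bundle (s : seq Res) : seq symbol := enc_list (map enc_res s).

Definition enc_bag (s : seq (seq Res)) : seq symbol :=
  enc_list (map enc_bundle s).

Definition lists_bundle (s : seq Res) (B : {mset Res}) : Prop :=
  seq_mset s = B.

Definition lists_bag (s : seq (seq Res)) (X : {mset {mset Res}}) : Prop :=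
  seq_mset [seq (seq_mset B : {mset Res}) | B <- s] = X.

(* Sets and multisets may be listed in any order, hence relations rather than
   functions. *)
Definition encodes_game (w : seq symbol) (G : rcg Res) : Prop :=
  exists (types : seq Res) (gs : 'I_(nplayers G) -> seq Res)
         (es : 'I_(nplayers G) -> seq (seq Res)),
    [/\ perm_eq types (enum Res),
        forall i, lists_bundle (gs i) (goal i),
        forall i, lists_bag (es i) (endowment i)
      & w = enc_list [:: enc_bundle types;
              enc_list [seq enc_list [:: enc_bundle (gs i); enc_bag (es i)]
                       | i <- enum 'I_(nplayers G)]]].

Definition encodes_profile (w : seq symbol) (G : rcg Res) (P : profile G) :
    Prop :=
  exists ps : 'I_(nplayers G) -> seq (seq Res),
    (forall i, lists_bag (ps i) (P i)) /\
    w = enc_list [seq enc_bag (ps i) | i <- enum 'I_(nplayers G)].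

End Encoding.

(* Main.v *)
From HB Require Import structures.
Require Import Defs.
From mathcomp Require Import all_boot all_order all_algebra.
From mathcomp Require Import finmap multiset zify.

(* For a set [T] of players let [sumg T] be the sum of their goals, and call [T]
   closed if [sumg T] satisfies nobody outside [T].  The players satisfied by an
   uncontentious outcome form a closed set.  Start from the closure of the empty
   set, with no contribution.  As long as there is a player [i] such that, for
   the closure [T'] of [T + i], the endowment of [i] covers the goals of
   [T' - T], let [i] contribute exactly these goals and replace [T] by [T'].
   A member of [T] can never stay satisfied without contention by giving less:
   for [i] by minimality of [T'], and for an older member because the players of
   [T' - T] are satisfied by what [i] adds, so that it could already have given
   less before.  When no step is possible, no player outside [T] can become
   satisfied without contention, so the profile is an equilibrium.

   The machine is obtained from a language of programs built from sweeps of
   tapes that all have the length of the input: a sweep runs its body once for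
   each cell, and every program restores the positions of the heads.  A program
   thus denotes a total function, and its running time is bounded by a
   polynomial read off its syntax.  The algorithm is written in this language
   on arrays of marks over the positions of the input word. *)

(** Why one passes to the closure [T']: the goal of [i] added to the outcome may satisfy outsiders
    by accident, and their goals then count for contention, so the newcomer must pay for all of
    them. Why the least closed set is the right price: any uncontentious outcome that contains the
    old total and satisfies [i] satisfies a closed set containing [T + i], hence [T']. Since the
    outcome is always exactly the sum of the goals in [T], there is no slack, and inequalities can
    be cancelled. Atomicity enters because satisfaction and contention only see the flattened
    outcome; for atomic bags flattening also reflects strict inclusion, so the game can be studied
    on multisets of atoms. The only loops available have the length [L] of the input. This is enough
    for every fixpoint, because sets of players grow at most [n] times and [n < L]. Multiset
    inclusion needs no counters: instances are paired greedily, which cannot go wrong since having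
    the same name is an equivalence. The output is a subword of the input up to the choice of kept
    symbols, so nothing has to be copied from elsewhere. *)

Set Implicit Arguments.
Unset Strict Implicit.
Unset Printing Implicit Defensive.

(** * Sweep programs and their Turing machines *)

Section SweepLanguage.

Variables (S F R : finType) (k : nat).

Local Notation wtape := 'I_k.+1.
Local Notation cells := {ffun wtape -> option R}.

(** In [Sweep c D p q] the tape [c] is a clock: [p] is run from left to right, [q] on the way back,
    and the blanks around the array of [c] end each pass. The tapes of [D] are dragged along from
    wherever they are, possibly past their end, where they read [None]. *)
Inductive prog :=
| Skip
| Upd of F -> cells -> F * (wtape -> R) * option S
| Seq of prog & prog
| If of F -> cells -> bool & prog & prog
| Sweep of wtape & seq wtape & prog & prog.

Record store := Store { fl : F; arr : wtape -> nat -> R; out : seq S }.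

Definition shift (mv : seq wtape) (h : wtape -> nat) (j : nat) (i : wtape) :=
  h i + (if i \in mv then j else 0).

Section Semantics.

Variable L : nat.

Definition reads (h : wtape -> nat) (s : store) : cells :=
  [ffun i => if h i < L then Some (arr s i (h i)) else None].

Fixpoint exec (p : prog) (h : wtape -> nat) (s : store) : store :=
  match p with
  | Skip => s
  | Upd f => let: (f', wr, e) := f (fl s) (reads h s) in
      Store f' (fun i x => if x == h i then wr i else arr s i x)
          (if e is Some a then a :: out s else out s)
  | Seq p q => exec q h (exec p h s)
  | If b p q => if b (fl s) (reads h s) then exec p h s else exec q h s
  | Sweep c D p q =>
      let s' := foldl (fun s j => exec p (shift (c :: D) h j) s) s (iota 0 L) in
      foldl (fun s j => exec q (shift (c :: D) h j) s) s' (rev (iota 0 L))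
  end.

End Semantics.

(* [B] lists the work tapes whose head may be away from the first cell. *)
Fixpoint wfp (B : seq wtape) (p : prog) : bool :=
  match p with
  | Skip | Upd _ => true
  | Seq p q | If _ p q => wfp B p && wfp B q
  | Sweep c D p q =>
      [&& c \notin B, c \notin D, wfp (c :: D ++ B) p & wfp (c :: D ++ B) q]
  end.

(** In each of the two passes a cell costs a loop test and a move, whence [4%:P]; the final [2%:P]
    is for the two exits. For [If] the sum of the branches replaces their maximum, and [2%:P] pays
    for the test and the jump. *)
Fixpoint cost (p : prog) : {poly nat} :=
  match p with
  | Skip => 0
  | Upd _ => 1
  | Seq p q => cost p + cost q
  | If _ p q => cost p + cost q + 2%:P
  | Sweep c D p q => 'X * (cost p + cost q + 4%:P) + 2%:P
  end%R.

Local Notation cell := (option (S + R)).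
Local Notation tapes := ('I_k.+2 -> tape (S + R)).

Definition work (i : wtape) : 'I_k.+2 := lift ord_max i.

(** The program counter is an argument, so that jumps are relative and compiled pieces can be
    concatenated unchanged. *)
Definition instr : Type :=
  nat -> F -> {ffun 'I_k.+2 -> cell} -> F * ('I_k.+2 -> cell * move) * nat.

Definition work_cells (c : {ffun 'I_k.+2 -> cell}) : cells :=
  [ffun i => if c (work i) is Some (inr r) then Some r else None].

(** Because of [omap] a blank cell stays blank: a write past the end of an array is lost, and the
    end markers of the clocks survive. *)
Definition upd_instr f : instr := fun pc a c =>
  let: (a', wr, e) := f a (work_cells c) in
  (a', fun j => if unlift ord_max j is Some i
                then (omap (fun=> inr (wr i)) (c j), MoveN)
                else if e is Some x then (Some (inl x), MoveL)
                else (c j, MoveN), pc.+1).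

Definition move_work (mv : seq wtape) (m : move) (c : {ffun 'I_k.+2 -> cell})
    (j : 'I_k.+2) : cell * move :=
  (c j, if unlift ord_max j is Some i then (if i \in mv then m else MoveN)
        else MoveN).

Definition move_instr mv m (tgt : nat -> nat) : instr := fun pc a c =>
  (a, move_work mv m c, tgt pc).

Definition test_instr b (tgt : nat -> nat) : instr := fun pc a c =>
  (a, move_work [::] MoveN c, if b a (work_cells c) then pc.+1 else tgt pc).

(** The exit move goes against the direction of the pass: it leads from the blank after the array
    back to the last cell, or from the blank before it back to the first. *)
Definition loop_instr (c : wtape) mv m (tgt : nat -> nat) : instr := fun pc a x =>
  if x (work c) then (a, move_work [::] MoveN x, pc.+1)
  else (a, move_work mv m x, tgt pc).

Fixpoint comp (p : prog) : seq instr :=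
  match p with
  | Skip => [::]
  | Upd f => [:: upd_instr f]
  | Seq p q => comp p ++ comp q
  | If b p q =>
      test_instr b (addn (size (comp p)).+2) ::
      comp p ++ move_instr [::] MoveN (addn (size (comp q)).+1) :: comp q
  | Sweep c D p q =>
      let mv := c :: D in
      loop_instr c mv MoveL (addn (size (comp p)).+2) ::
      comp p ++ move_instr mv MoveR (subn^~ (size (comp p)).+1) ::
      loop_instr c mv MoveR (addn (size (comp q)).+2) ::
      comp q ++ [:: move_instr mv MoveL (subn^~ (size (comp q)).+1)]
  end.

Definition conf : Type := (nat * F * tapes)%type.

Definition nop : instr := fun pc a c => (a, move_work [::] MoveN c, pc).

Definition apply_act (act : 'I_k.+2 -> cell * move) (ts : tapes) : tapes :=
  fun j => tape_move (act j).2 (tape_write (act j).1 (ts j)).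

Definition step1 (code : seq instr) (x : conf) : conf :=
  let: (pc, a, ts) := x in
  let: (a', act, pc') := nth nop code pc pc a [ffun j => tape_cur (ts j)] in
  (pc', a', apply_act act ts).

Inductive crun (code : seq instr) : nat -> conf -> conf -> Prop :=
| crun0 x : crun code 0 x x
| crunS n x y :
    x.1.1 < size code -> crun code n (step1 code x) y -> crun code n.+1 x y.

Lemma crun_trans code n m x y z :
  crun code n x y -> crun code m y z -> crun code (n + m) x z.
Proof. by move=> H; elim: H z => // {}n {}x {}y lt_x _ IH z /IH; exact: crunS. Qed.

Lemma crun1 code pre i post pc a ts :
  code = pre ++ i :: post -> pc = size pre ->
  crun code 1 (pc, a, ts)
    (let: (a', act, pc') := i pc a [ffun j => tape_cur (ts j)] in
     (pc', a', apply_act act ts)).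
Proof.
move=> -> ->; apply: crunS; first by rewrite /= size_cat /= -addSnnS leq_addr.
by rewrite /= nth_cat ltnn subnn /=; exact: crun0.
Qed.

(* Contents of a tape as a function of the absolute position; the array cell
   [x] is at position [x.+1], so that position [0] is always blank. *)
Definition tape_rep (t : tape (S + R)) (g : nat -> cell) (p : nat) : Prop :=
  [/\ forall j, nth None (tape_left t) j = if j < p then g (p - j.+1) else None,
      tape_cur t = g p
    & forall j, nth None (tape_right t) j = g (p + j.+1)].

Lemma tape_rep_eq t g g' p : g =1 g' -> tape_rep t g p -> tape_rep t g' p.
Proof.
by move=> e [l c r]; split=> [j||j]; rewrite -?e // l; case: ifP => // _; rewrite e.
Qed.

Lemma tape_rep_write c t g p :
  tape_rep t g p -> tape_rep (tape_write c t) (fun x => if x == p then c else g x) p.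
Proof.
case: t => l0 c0 r0 [/= l cu r]; split=> /= [j||j]; rewrite ?eqxx //.
  by rewrite l; case: ifP => // lt_jp; case: eqP => //; lia.
by rewrite r; case: eqP => //; lia.
Qed.

Lemma tape_rep_moveR t g p : tape_rep t g p -> tape_rep (tape_move MoveR t) g p.+1.
Proof.
case: t => l0 c0 r0 [/= l cu r]; split=> /= [[|j]||j].
- by rewrite /= subn1.
- by rewrite /= l ltnS; case: ifP => // _; congr g; lia.
- by have := r 0; rewrite addn1 => <-; case: (r0).
by rewrite nth_behead r; congr g; lia.
Qed.

Lemma tape_rep_moveL t g p : tape_rep t g p.+1 -> tape_rep (tape_move MoveL t) g p.
Proof.
case: t => l0 c0 r0 [/= l cu r]; split=> /= [j||[|j]].
- by rewrite nth_behead l ltnS; case: ifP => // _; congr g; lia.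
- by have := l 0; rewrite subn1 /= => <-; case: (l0).
- by rewrite /= addn1.
by rewrite /= r; congr g; lia.
Qed.

Lemma tape_write_cur (t : tape (S + R)) : tape_write (tape_cur t) t = t.
Proof. by case: t. Qed.

Fixpoint lead (s : seq cell) : seq S :=
  if s is Some (inl a) :: s' then a :: lead s' else [::].

(* The output grows leftwards, its head staying on the blank cell that
   precedes it. *)
Definition out_rep (t : tape (S + R)) (v : seq S) : Prop :=
  [/\ tape_cur t = None, forall j, nth None (tape_left t) j = None
    & lead (tape_right t) = v].

Section Correctness.

Variable L : nat.

Definition cell_at (a : nat -> R) (p : nat) : cell :=
  if p is x.+1 then (if x < L then Some (inr (a x)) else None) else None.

Definition rep (ts : tapes) (H : wtape -> nat) (s : store) : Prop :=
  (forall i, tape_rep (ts (work i)) (cell_at (arr s i)) (H i)) /\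
  out_rep (ts ord_max) (out s).

Lemma unlift_work i : unlift ord_max (work i) = Some i.
Proof. exact: liftK. Qed.

Lemma rep_heads ts H H' s : H =1 H' -> rep ts H s -> rep ts H' s.
Proof. by move=> e [Hw Ho]; split=> // i; rewrite -e. Qed.

Lemma rep_still ts H s :
  rep ts H s ->
  rep (apply_act (move_work [::] MoveN [ffun j => tape_cur (ts j)]) ts) H s.
Proof.
move=> [Hw Ho]; split=> [i|]; rewrite /apply_act /= ffunE tape_write_cur.
  by rewrite unlift_work; case: (ts _) (Hw i).
by rewrite unlift_none; case: (ts _) Ho.
Qed.

Lemma rep_moveR ts H s mv :
  rep ts H s ->
  rep (apply_act (move_work mv MoveR [ffun j => tape_cur (ts j)]) ts)
      (fun i => H i + (i \in mv)) s.
Proof.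
move=> [Hw Ho]; split=> [i|]; rewrite /apply_act /= ffunE tape_write_cur.
  rewrite unlift_work; case: ifP => _; last by rewrite addn0; case: (ts _) (Hw i).
  by rewrite addn1; have := tape_rep_moveR (Hw i); case: (ts _).
by rewrite unlift_none; case: (ts _) Ho.
Qed.

Lemma rep_moveL ts H s mv :
  rep ts (fun i => H i + (i \in mv)) s ->
  rep (apply_act (move_work mv MoveL [ffun j => tape_cur (ts j)]) ts) H s.
Proof.
move=> [Hw Ho]; split=> [i|]; rewrite /apply_act /= ffunE tape_write_cur.
  rewrite unlift_work; have := Hw i.
  case: ifP => _; last by rewrite addn0; case: (ts _).
  by rewrite addn1 => /tape_rep_moveL; case: (ts _).
by rewrite unlift_none; case: (ts _) Ho.
Qed.

Lemma rep_cells ts h s :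
  rep ts (fun i => (h i).+1) s ->
  work_cells [ffun j => tape_cur (ts j)] = reads L h s.
Proof.
move=> [Hw _]; apply/ffunP => i; rewrite !ffunE.
by have [_ -> _] := Hw i; rewrite /cell_at; case: ifP.
Qed.

Lemma rep_upd ts h s f :
  rep ts (fun i => (h i).+1) s ->
  let: (a', wr, e) := f (fl s) (reads L h s) in
  let: (a'', act, _) := upd_instr f 0 (fl s) [ffun j => tape_cur (ts j)] in
  a'' = a' /\ rep (apply_act act ts) (fun i => (h i).+1) (exec L (Upd f) h s).
Proof.
move=> Hr; have Hc := rep_cells Hr; rewrite /upd_instr Hc /=.
case: (f _ _) => [[a' wr] e]; split=> //; case: Hr => Hw [Hcur Hl Hlead].
split=> [i|]; rewrite /apply_act /=.
  rewrite unlift_work ffunE /=.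
  have [_ Ec _] := Hw i; have := tape_rep_write (omap (fun=> inr (wr i)) (tape_cur (ts (work i)))) (Hw i).
  case: (tape_write _ _) => l0 c0 r0; apply: tape_rep_eq => x.
  rewrite Ec; case: x => [|x] //=; rewrite eqSS; case: eqP => [->|_] //.
  by case: ifP.
rewrite unlift_none; case: e => [x|] /=; last first.
  by rewrite ffunE tape_write_cur; case: (ts _) Hcur Hl Hlead.
case: (ts _) Hcur Hl Hlead => l0 c0 r0 /= _ Hl Hlead; split=> [|j|] /=.
- by have := Hl 0; case: (l0).
- by rewrite nth_behead.
by rewrite Hlead.
Qed.

(** The prefix and the head positions are arbitrary because a body is executed in the middle of the
    code and at every shift of the enclosing sweeps. *)
Definition correct_at (code : seq instr) p (pre : seq instr) (h : wtape -> nat) : Prop :=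
  forall s ts, rep ts (fun i => (h i).+1) s ->
  exists n ts',
    [/\ n <= (cost p).[L]%R,
        crun code n (size pre, fl s, ts)
          (size pre + size (comp p), fl (exec L p h s), ts')
      & rep ts' (fun i => (h i).+1) (exec L p h s)].

Lemma run_forward code pre post c D p cq h :
  code = pre ++ loop_instr c (c :: D) MoveL (addn (size (comp p)).+2) ::
         comp p ++ move_instr (c :: D) MoveR (subn^~ (size (comp p)).+1) :: cq
           ++ post ->
  h c = 0 ->
  (forall j, correct_at code p
     (pre ++ [:: loop_instr c (c :: D) MoveL (addn (size (comp p)).+2)])
     (shift (c :: D) h j)) ->
  forall m j s ts, j + m = L ->
  rep ts (fun i => (shift (c :: D) h j i).+1) s ->
  let s' := foldl (fun s j => exec L p (shift (c :: D) h j) s) s (iota j m) in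
  exists n ts',
    [/\ n <= m * ((cost p).[L]%R + 2),
        crun code n (size pre, fl s, ts) (size pre, fl s', ts')
      & rep ts' (fun i => (shift (c :: D) h L i).+1) s'].
Proof.
move=> Ecode hc Hp; elim=> [|m IH] j s ts Ej Hr.
  by exists 0, ts; split=> //=; [exact: crun0 | rewrite -Ej addn0].
have R1 := crun1 (fl s) ts Ecode (erefl _).
have Enb : isSome (tape_cur (ts (work c))).
  have [Hw _] := Hr; have [_ -> _] := Hw c.
  by rewrite /= /shift hc mem_head /= add0n; case: ifP => //; lia.
rewrite /loop_instr ffunE Enb in R1.
have [n1 [ts1 [le1 R2 Hr1]]] := Hp j s _ (rep_still Hr).
rewrite size_cat addn1 in R2.
have R3 := crun1 (fl (exec L p (shift (c :: D) h j) s)) ts1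
  (pre := (pre ++ [:: loop_instr c (c :: D) MoveL (addn (size (comp p)).+2)]) ++ comp p)
  (i := move_instr (c :: D) MoveR (subn^~ (size (comp p)).+1)) (post := cq ++ post)
  (code := code) (pc := (size pre).+1 + size (comp p)).
have {R3} := R3 _ _; rewrite {1}Ecode -!catA /= => /(_ (erefl _)).
move=> R3'; have {R3'}R3 := R3' ltac:(by rewrite !size_cat /=; lia).
have Epc : (size pre).+1 + size (comp p) - (size (comp p)).+1 = size pre by lia.
rewrite /move_instr Epc in R3.
have Hr2 := rep_moveR (c :: D) Hr1.
have {}Hr2 : rep (apply_act (move_work (c :: D) MoveR [ffun j => tape_cur (ts1 j)]) ts1)
    (fun i => (shift (c :: D) h j.+1 i).+1) (exec L p (shift (c :: D) h j) s).
  by apply: rep_heads Hr2 => i; rewrite /shift; case: (i \in _); lia.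
have [|n2 [ts2 [le2 R4 Hr4]]] := IH j.+1 _ _ _ Hr2; first by lia.
exists (1 + (n1 + (1 + n2))), ts2; split=> //; first by rewrite mulSn; lia.
exact: crun_trans R1 (crun_trans R2 (crun_trans R3 R4)).
Qed.

(** With [m] cells left the swept heads are at [h i + m], that is, on array index [h i + m - 1]; for
    [m = 0] the clock is on the blank at position 0, which ends the pass. *)
Lemma run_backward code pre post c D q h :
  code = pre ++ loop_instr c (c :: D) MoveR (addn (size (comp q)).+2) ::
         comp q ++ move_instr (c :: D) MoveL (subn^~ (size (comp q)).+1) :: post ->
  h c = 0 -> c \notin D ->
  (forall j, correct_at code q
     (pre ++ [:: loop_instr c (c :: D) MoveR (addn (size (comp q)).+2)])
     (shift (c :: D) h j)) ->
  forall m s ts, m <= L ->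
  rep ts (fun i => h i + (if i \in c :: D then m else 1)) s ->
  let s' := foldl (fun s j => exec L q (shift (c :: D) h j) s) s (rev (iota 0 m)) in
  exists n ts',
    [/\ n <= m * ((cost q).[L]%R + 2),
        crun code n (size pre, fl s, ts) (size pre, fl s', ts')
      & rep ts' (fun i => h i + (i \notin c :: D)) s'].
Proof.
move=> Ecode hc ncD Hq; elim=> [|m IH] s ts Em Hr.
  exists 0, ts; split=> //=; first exact: crun0.
  by apply: rep_heads Hr => i; case: (i \in _).
have -> : rev (iota 0 m.+1) = m :: rev (iota 0 m).
  by rewrite -addn1 iotaD cats1 rev_rcons.
have R1 := crun1 (fl s) ts Ecode (erefl _).
have Enb : isSome (tape_cur (ts (work c))).
  have [Hw _] := Hr; have [_ -> _] := Hw c.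
  by rewrite /= hc mem_head add0n /= Em.
rewrite /loop_instr ffunE Enb in R1.
have Hr' : rep ts (fun i => (shift (c :: D) h m i).+1) s.
  by apply: rep_heads Hr => i; rewrite /shift; case: (i \in _); lia.
have [n1 [ts1 [le1 R2 Hr1]]] := Hq m s _ (rep_still Hr').
rewrite size_cat addn1 in R2.
have R3 := crun1 (fl (exec L q (shift (c :: D) h m) s)) ts1
  (pre := (pre ++ [:: loop_instr c (c :: D) MoveR (addn (size (comp q)).+2)]) ++ comp q)
  (i := move_instr (c :: D) MoveL (subn^~ (size (comp q)).+1)) (post := post)
  (code := code) (pc := (size pre).+1 + size (comp q)).
have {R3} := R3 _ _; rewrite {1}Ecode -!catA /= => /(_ (erefl _)).
move=> R3'; have {R3'}R3 := R3' ltac:(by rewrite !size_cat /=; lia).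
have Epc : (size pre).+1 + size (comp q) - (size (comp q)).+1 = size pre by lia.
rewrite /move_instr Epc in R3.
have {}Hr1 : rep ts1 (fun i => h i + (if i \in c :: D then m else 1) + (i \in c :: D))
    (exec L q (shift (c :: D) h m) s).
  by apply: rep_heads Hr1 => i; rewrite /shift; case: (i \in _); lia.
have [|n2 [ts2 [le2 R4 Hr4]]] := IH _ _ _ (rep_moveL Hr1); first by lia.
exists (1 + (n1 + (1 + n2))), ts2.
split=> //; first by rewrite mulSn; lia.
exact: crun_trans R1 (crun_trans R2 (crun_trans R3 R4)).
Qed.

Lemma comp_correct p code pre post B h :
  wfp B p -> code = pre ++ comp p ++ post ->
  (forall i, i \notin B -> h i = 0) -> correct_at code p pre h.
Proof.
elim: p pre post B h => [|f|p IHp q IHq|b p IHp q IHq|c D p IHp q IHq]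
    pre post B h /=.
- move=> _ _ _ s ts Hr; exists 0, ts; split=> //.
  by rewrite addn0; exact: crun0.
- move=> _ Ecode _ s ts Hr.
  have := rep_upd f Hr; have R1 := crun1 (fl s) ts Ecode (erefl _).
  move: R1; rewrite /upd_instr /= (rep_cells Hr).
  case: (f _ _) => [[a' wr] e] /= R1 [_ Hr'].
  exists 1; eexists; split; last exact: Hr'; first by rewrite -polyC1 hornerC.
  by rewrite addn1.
- case/andP=> wp wq Ecode Hh s ts Hr.
  have [|n1 [ts1 [le1 R1 Hr1]]] := IHp pre (comp q ++ post) B h wp _ Hh s ts Hr.
    by rewrite Ecode -catA.
  have [|n2 [ts2 [le2 R2 Hr2]]] := IHq (pre ++ comp p) post B h wq _ Hh _ ts1 Hr1.
    by rewrite Ecode -!catA.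
  exists (n1 + n2), ts2; split=> //; first by rewrite hornerD leq_add.
  by rewrite size_cat addnA; apply: crun_trans R1 _; rewrite -size_cat.
- case/andP=> wp wq Ecode Hh s ts Hr.
  have R1 := crun1 (fl s) ts Ecode (erefl _).
  rewrite /test_instr (rep_cells Hr) in R1.
  have Hr1 := rep_still Hr.
  rewrite /=; case: ifP R1 => Eb R1.
    have [|n2 [ts2 [le2 R2 Hr2]]] := IHp (rcons pre (test_instr b (addn (size (comp p)).+2)))
      (move_instr [::] MoveN (addn (size (comp q)).+1) :: comp q ++ post) B h wp _ Hh _ _ Hr1.
      by rewrite Ecode cat_rcons -!catA.
    rewrite size_rcons in R2.
    have R3 := crun1 (fl (exec L p h s)) ts2
      (pre := (rcons pre (test_instr b (addn (size (comp p)).+2))) ++ comp p)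
      (i := move_instr [::] MoveN (addn (size (comp q)).+1)) (post := comp q ++ post)
      (code := code) (pc := (size pre).+1 + size (comp p)).
    have {R3} := R3 _ _; rewrite {1}Ecode cat_rcons -!catA /= => /(_ (erefl _)).
    move=> R3'; have {R3'}R3 := R3' ltac:(by rewrite !size_cat ?size_rcons /=; lia).
    exists (1 + (n2 + 1)); eexists; split; last exact: rep_still Hr2.
      by rewrite !hornerD hornerC; have : 0 <= (cost q).[L]%R by []; lia.
    have -> : size pre + (size (comp p ++ move_instr [::] MoveN
        (addn (size (comp q)).+1) :: comp q)).+1 =
      (size (comp q)).+1 + ((size pre).+1 + size (comp p)) by rewrite size_cat /=; lia.
    exact: crun_trans R1 (crun_trans R2 R3).
  have [|n2 [ts2 [le2 R2 Hr2]]] := IHq (rcons pre (test_instr b (addn (size (comp p)).+2)) ++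
     comp p ++ [:: move_instr [::] MoveN (addn (size (comp q)).+1)]) post B h wq _ Hh _ _ Hr1.
    by rewrite Ecode cat_rcons /= -?catA /= -?catA /= -?catA.
  rewrite !size_cat size_rcons /= in R2.
  exists (1 + n2), ts2; split=> //.
    by rewrite !hornerD hornerC; have : 0 <= (cost p).[L]%R by []; lia.
  apply: crun_trans R1 _.
  have -> : (size (comp p)).+2 + size pre = (size pre).+1 + (size (comp p) + 1) by lia.
  have -> // : size pre + (size (comp p ++ move_instr [::] MoveN
      (addn (size (comp q)).+1) :: comp q)).+1 =
    (size pre).+1 + (size (comp p) + 1) + size (comp q) by rewrite size_cat /=; lia.
case/and4P=> ncB ncD wp wq Ecode Hh s ts Hr.
have hc : h c = 0 by exact: Hh.
have Hsh j i : i \notin c :: D ++ B -> shift (c :: D) h j i = 0.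
  rewrite -cat_cons mem_cat negb_or => /andP[/negPf ncD' nB].
  by rewrite /shift ncD' Hh.
pose mv := c :: D.
pose hF := loop_instr c mv MoveL (addn (size (comp p)).+2).
pose bF := move_instr mv MoveR (subn^~ (size (comp p)).+1).
pose hB := loop_instr c mv MoveR (addn (size (comp q)).+2).
pose bB := move_instr mv MoveL (subn^~ (size (comp q)).+1).
have EcF : code = pre ++ hF :: comp p ++ bF :: (hB :: comp q ++ [:: bB]) ++ post.
  by rewrite Ecode /= -!catA /= -!catA.
have EcB : code = (pre ++ hF :: comp p ++ [:: bF]) ++ hB :: comp q ++ bB :: post.
  by rewrite EcF /= -!catA /= -!catA.
have {}IHp j : correct_at code p (pre ++ [:: hF]) (shift mv h j).
  apply: (IHp _ (bF :: (hB :: comp q ++ [:: bB]) ++ post) (c :: D ++ B)) => //.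
    by rewrite EcF -!catA.
  exact: Hsh.
have {}IHq j : correct_at code q ((pre ++ hF :: comp p ++ [:: bF]) ++ [:: hB]) (shift mv h j).
  apply: (IHq _ (bB :: post) (c :: D ++ B)) => //.
    by rewrite EcB -!catA.
  exact: Hsh.
have [||n1 [ts1 [le1 R1 Hr1]]] := @run_forward _ _ _ _ _ _ _ h EcF hc IHp L 0 s ts.
- by [].
- by apply: rep_heads Hr => i; rewrite /shift if_same addn0.
set s1 := foldl _ s (iota 0 L) in R1 Hr1 *.
have R2 := crun1 (fl s1) ts1 EcF (erefl _).
have Enb : isSome (tape_cur (ts1 (work c))) = false.
  have [Hw _] := Hr1; have [_ -> _] := Hw c.
  by rewrite /= /shift hc mem_head /= add0n ltnn.
rewrite /hF /loop_instr ffunE Enb in R2.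
have {}Hr1 : rep ts1 (fun i => h i + (if i \in mv then L else 1) + (i \in mv)) s1.
  by apply: rep_heads Hr1 => i; rewrite /shift -/mv; case: (i \in _); lia.
have [n3 [ts3 [le3 R3 Hr3]]] :=
  @run_backward _ _ _ _ _ _ h EcB hc ncD IHq L s1 _ (leqnn L) (rep_moveL Hr1).
set s2 := foldl _ s1 _ in R3 Hr3 *.
have R4 := crun1 (fl s2) ts3 EcB (erefl _).
have Enb2 : isSome (tape_cur (ts3 (work c))) = false.
  have [Hw _] := Hr3; have [_ -> _] := Hw c.
  by rewrite /= hc mem_head.
rewrite /hB /loop_instr ffunE Enb2 in R4.
have Hr4 := rep_moveR mv Hr3.
exists (n1 + (1 + (n3 + 1))); eexists; split; last first.
- by apply: rep_heads Hr4 => i; rewrite -/mv; case: (i \in _); lia.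
- have -> : size pre + (size (comp p ++ bF :: hB :: comp q ++ [:: bB])).+1 =
      (size (comp q)).+2 + size (pre ++ hF :: comp p ++ [:: bF]).
    by rewrite !size_cat /= !size_cat /=; lia.
  apply: crun_trans R1 (crun_trans R2 (crun_trans _ R4)).
  have -> // : (size (comp p)).+2 + size pre = size (pre ++ hF :: comp p ++ [:: bF]).
  by rewrite !size_cat /= !size_cat /=; lia.
rewrite hornerD hornerM !hornerD !hornerC hornerX.
have : (L * ((cost p).[L]%R + (cost q).[L]%R + 4) =
  L * ((cost p).[L]%R + 2) + L * ((cost q).[L]%R + 2))%N by lia.
move: le1 le3; set a := (L * (_ + 2))%N; set b := (L * (_ + 2))%N.
move=> le1 le3 E.
suff : (n1 + (1 + (n3 + 1)) <= L * ((cost p).[L]%R + (cost q).[L]%R + 4) + 2)%N by [].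
by rewrite E; lia.
Qed.

End Correctness.

(** * Loading the input, rewinding, and delivering the output *)

Section Machine.

Variables (ini : S -> R) (r0 : R) (a0 : F) (p : prog).

(** Every work tape receives its own copy of the input, which gives all arrays, clocks included, the
    same length. *)
Definition load_instr : instr := fun pc a c =>
  if c (work ord0) is Some (inl x)
  then (a, fun j => if unlift ord_max j is Some _ then (Some (inr (ini x)), MoveR)
                    else (c j, MoveN), pc)
  else (a, move_work (enum wtape) MoveL c, pc.+1).

Definition rewind_instr : instr := fun pc a c =>
  if c (work ord0) then (a, move_work (enum wtape) MoveL c, pc)
  else (a, move_work (enum wtape) MoveR c, pc.+1).

Definition finish_instr : instr := fun pc a c =>
  (a, fun j => (c j, if j == ord_max then MoveR else MoveN), pc.+1).

Definition machine_code : seq instr :=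
  load_instr :: rewind_instr :: comp p ++ [:: finish_instr].

Definition machine_trans (q : 'I_(size machine_code).+1 * F)
    (c : {ffun 'I_k.+2 -> cell}) :
    option (('I_(size machine_code).+1 * F) * ('I_k.+2 -> cell * move)) :=
  if q.1 < size machine_code then
    let: (a, act, pc) := nth nop machine_code q.1 q.1 q.2 c in
    Some ((inord pc, a), act)
  else None.

Definition machine : tm S :=
  @TM S k.+1 R ('I_(size machine_code).+1 * F)%type (ord0, a0) machine_trans.

Definition cfg (x : conf) : tm_config machine := ((inord x.1.1, x.1.2), x.2).

Lemma crun_le n x y :
  crun machine_code n x y -> y.1.1 <= size machine_code ->
  x.1.1 <= size machine_code.
Proof. by case=> // {}n {}x {}y /ltnW. Qed.

(** The state of the machine stores the counter in a bounded ordinal. Each step of [crun] starts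
    inside the code and the last counter is bounded by hypothesis, so [inord] loses nothing along
    the run. *)
Lemma crun_tm_steps n x y :
  crun machine_code n x y -> y.1.1 <= size machine_code ->
  tm_steps n (cfg x) = Some (cfg y).
Proof.
elim=> // {}n {}x {}y lt_x Hr IH le_y; rewrite -IH //.
have := crun_le Hr le_y; case: x lt_x {Hr IH} => [[pc a] ts] /= lt_pc.
rewrite /machine_trans /= inordK; last exact: leqW.
by rewrite lt_pc; case: (nth _ _ _ _ _ _) => [[a' act] pc'].
Qed.

Section Loading.

Variable w : seq S.

Local Notation L := (size w).

Definition init_store : store := Store a0 (fun=> nth r0 (map ini w)) [::].

Definition load_cell (i : wtape) (j x : nat) : cell :=
  if x is x'.+1 then
    if x' < j then Some (inr (nth r0 (map ini w) x'))
    else if i == ord0 then omap inl (onth w x') else None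
  else None.

Definition load_rep (ts : tapes) (j : nat) : Prop :=
  (forall i, tape_rep (ts (work i)) (load_cell i j) j.+1) /\
  out_rep (ts ord_max) [::].

Lemma load_rep_init : load_rep (tm_init machine w).2 0.
Proof.
have E i : (work i == ord0) = (i == ord0) by rewrite -!val_eqE /= /bump; case: i; lia.
have B j : nth None [::] j = None :> cell by exact: nth_nil.
split=> [i|]; last by split=> //=; exact: nth_nil.
rewrite /= E /load_cell; case: (i == ord0); split=> [j||j] /=; rewrite ?B //.
- by case: ifP => //; case: j.
- by case: (w).
- rewrite nth_behead; case: (w) => [|b u] //=; rewrite onthE.
  by elim: u j => [|b' u IH] [|j] /=.
- by case: ifP.
Qed.

Lemma load_step ts j :
  j < L -> load_rep ts j ->
  exists2 ts', load_rep ts' j.+1 &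
    crun machine_code 1 (0, a0, ts) (0, a0, ts').
Proof.
move=> lt_j [Hw Ho].
have R1 := crun1 a0 ts (erefl machine_code : _ = [::] ++ load_instr :: _) (erefl _).
have [_ Ec _] := Hw ord0.
have [b Eb] : exists b, onth w j = Some b.
  by have := onthTE w j; rewrite lt_j; case: (onth w j) => // b _; exists b.
rewrite /load_instr ffunE Ec /= ltnn Eb /= in R1.
eexists; last exact: R1.
split=> [i|]; rewrite /apply_act /=; last first.
  by rewrite unlift_none ffunE tape_write_cur; case: (ts _) Ho.
rewrite unlift_work.
have := tape_rep_moveR (tape_rep_write (Some (inr (ini b))) (Hw i)).
apply: tape_rep_eq => -[|x] //=; rewrite eqSS ltnS; case: ltngtP => // ->.
by rewrite (nth_map b) // (onth_nth _ _ _ _ Eb).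
Qed.

Lemma load_loop m j ts :
  j + m = L -> load_rep ts j ->
  exists2 ts', load_rep ts' L &
    crun machine_code m (0, a0, ts) (0, a0, ts').
Proof.
elim: m j ts => [|m IH] j ts Ej Hr.
  by exists ts; [rewrite -Ej addn0 | exact: crun0].
have [|ts1 Hr1 R1] := load_step _ Hr; first by lia.
have [|ts2 Hr2 R2] := IH j.+1 ts1 _ Hr1; first by lia.
by exists ts2 => //; exact: crun_trans R1 R2.
Qed.

Lemma load_done ts :
  load_rep ts L -> rep L ts (fun=> L.+1) init_store.
Proof.
move=> [Hw Ho]; split=> // i; apply: tape_rep_eq (Hw i) => -[|x] //=.
case: ltnP => // le_x; case: eqP => // _.
by rewrite onth_default.
Qed.

Lemma rewind_loop m ts :
  m <= L -> rep L ts (fun=> m) init_store ->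
  exists2 ts', rep L ts' (fun=> 1) init_store &
    crun machine_code m.+1 (1, a0, ts) (2, a0, ts').
Proof.
have R1 ts1 := crun1 a0 ts1
  (erefl machine_code : _ = [:: load_instr] ++ rewind_instr :: _) (erefl _).
elim: m ts => [|m IH] ts le_m Hr.
  eexists; last first.
    have := R1 ts; rewrite /rewind_instr ffunE.
    by have [Hw _] := Hr; have [_ -> _] /= := Hw ord0; apply.
  by apply: rep_heads (rep_moveR _ Hr) => i; rewrite mem_enum.
have Hr' : rep L ts (fun i => m + (i \in enum wtape)) init_store.
  by apply: rep_heads Hr => i; rewrite mem_enum addn1.
have [|ts1 Hr1 R2] := IH _ _ (rep_moveL Hr'); first exact: ltnW.
exists ts1 => //; rewrite -[m.+2]/(1 + m.+1); apply: crun_trans R2.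
have := R1 ts; rewrite /rewind_instr ffunE.
by have [Hw _] := Hr; have [_ -> _] /= := Hw ord0; rewrite le_m; apply.
Qed.

(** The linear term pays for loading and rewinding, the constant for the single steps between the
    phases. *)
Lemma machine_correct :
  wfp [::] p ->
  exists2 t, t <= (cost p + 2%:P * 'X + 4%:P).[L]%R &
    tm_computes machine w t (out (exec L p (fun=> 0) init_store)).
Proof.
move=> wf_p.
have [ts1 Hr1 R1] := load_loop (erefl : 0 + L = L) load_rep_init.
have R2 := crun1 a0 ts1
  (erefl machine_code : _ = [::] ++ load_instr :: _) (erefl _).
have Eb : tape_cur (ts1 (work ord0)) = None.
  have [Hw _] := load_done Hr1; have [_ -> _] := Hw ord0.
  by rewrite /= ltnn.
rewrite /load_instr ffunE Eb in R2.
have Hr1' : rep L ts1 (fun i => L + (i \in enum wtape)) init_store.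
  by apply: rep_heads (load_done Hr1) => i; rewrite mem_enum addn1.
have [ts3 Hr3 R3] := rewind_loop (leqnn L) (rep_moveL Hr1').
have [n [ts4 [le_n R4 Hr4]]] := comp_correct wf_p
  (erefl machine_code : _ = [:: load_instr; rewind_instr] ++ comp p ++ [:: finish_instr])
  (fun i (_ : i \notin [::]) => erefl 0) Hr3.
set m := exec L p _ init_store in R4 Hr4 *.
have R5 := crun1 (fl m) ts4
  (erefl machine_code : _ = ([:: load_instr; rewind_instr] ++ comp p) ++ finish_instr :: [::])
  (erefl _).
exists (L + (1 + (L.+1 + (n + 1)))).
  rewrite !hornerD hornerM !hornerC hornerX.
  suff : (L + (1 + (L.+1 + (n + 1))) <= (cost p).[L]%R + 2 * L + 4)%N by [].
  by move: le_n; set c := (cost p).[L]%R; lia.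
have Rall := crun_trans R1 (crun_trans R2 (crun_trans R3 (crun_trans R4 R5))).
have Esz : size machine_code = (size (comp p)).+3 by rewrite /= size_cat addn1.
have Hsteps := crun_tm_steps Rall ltac:(by rewrite Esz /=).
move: Hsteps; set y := (X in Some X) => Hsteps; exists y; split.
- by rewrite -Hsteps; congr (tm_steps _ _); congr (_, _, _); apply: val_inj; rewrite /= inordK.
- rewrite /y /tm_step /= /machine_trans.
  suff -> : (inord (size (comp p)).+3 : 'I_(size machine_code).+1) <
    size machine_code = false by [].
  by rewrite inordK Esz ?ltnn.
have [_ [Hc Hl Ho]] := Hr4.
rewrite /y /tm_output /apply_act /cfg /= eqxx ffunE -Ho.
by case: (ts4 ord_max) => l c [|b r].
Qed.

End Loading.

End Machine.

End SweepLanguage.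

(** * Equilibria *)

Local Open Scope mset_scope.

(** * Inflationary iterations on subsets of a finite type *)

Section Inflationary.

Variable X : finType.

(** Until it is stationary the sequence gains an element at each step, which can happen at most
    [#|X|] times. *)
Lemma iter_inflationary_fix (f : {set X} -> {set X}) m (T : {set X}) :
  (forall U : {set X}, U \subset f U) -> #|X| <= m -> f (iter m f T) = iter m f T.
Proof.
move=> f_infl le_m.
have : m <= #|iter m f T| \/ f (iter m f T) = iter m f T.
  elim: m {le_m} => [|m [IH|IH]] /=; [by left | | by right; rewrite !IH].
  have [E|neq] := eqVneq (iter m f T) (f (iter m f T)); first by right; rewrite -E.
  by left; apply: leq_ltn_trans IH (proper_card _); rewrite properEneq neq f_infl.
case=> // le; apply/eqP; rewrite eq_sym eqEcard f_infl.
by apply: leq_trans (max_card _) (leq_trans le_m le).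
Qed.

Lemma iter_inflationary (f : {set X} -> {set X}) m (T : {set X}) :
  (forall U : {set X}, U \subset f U) -> T \subset iter m f T.
Proof. by move=> f_infl; elim: m => //= m /subset_trans; apply. Qed.

Variables (A : eqType) (step : {set X} -> A -> {set X}).
Hypothesis step_infl : forall (U : {set X}) b, U \subset step U b.

Lemma foldl_inflationary (T : {set X}) s : T \subset foldl step T s.
Proof. by elim: s T => //= b s IH T; apply: subset_trans (IH _). Qed.

(** Growth is never undone, so a pass without net effect consists of idle steps only. *)
Lemma foldl_inflationary_fix (T : {set X}) s b :
  foldl step T s = T -> b \in s -> step T b = T.
Proof.
elim: s => //= a s IH E; have Ea : step T a = T.
  by apply/eqP; rewrite eqEsubset step_infl andbT -{2}E foldl_inflationary.
by rewrite Ea in E; rewrite inE => /predU1P[-> // | /(IH E)].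
Qed.

End Inflationary.

HB.instance Definition _ (K : choiceType) :=
  Monoid.isComLaw.Build {mset K} mset0 (@msetD K) (@msetDA K) (@msetDC K) (@mset0D K).

(** * The game on multisets of atoms and its closed sets of players *)

Section FlatGame.

Variables (Res : choiceType) (n : nat) (gam eps : 'I_n -> {mset Res}).

Implicit Types (T U W : {set 'I_n}) (O C : {mset Res}) (f : 'I_n -> {mset Res}).

Lemma big_msetDE (I : Type) (r : seq I) (p : pred I) (f : I -> {mset Res}) a :
  (\big[msetD/mset0]_(i <- r | p i) f i) a = \sum_(i <- r | p i) f i a.
Proof.
by apply: (big_morph (fun A : {mset Res} => A a)) => [A B|]; rewrite ?msetE2 ?mset0E.
Qed.

Definition sumg T : {mset Res} := \big[msetD/mset0]_(i in T) gam i.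

Lemma sumg_sub T U : T \subset U -> sumg T `<=` sumg U.
Proof.
move=> sTU; apply/msubsetP => a; rewrite !big_msetDE [X in _ <= X](big_setID T) /=.
by rewrite (setIidPr sTU) leq_addr.
Qed.

Lemma sumg_split T U : T \subset U -> sumg U = sumg T `+` sumg (U :\: T).
Proof.
move=> sTU; apply/msetP => a; rewrite msetE2 !big_msetDE [LHS](big_setID T) /=.
by rewrite (setIidPr sTU).
Qed.

Lemma sumg0 : sumg set0 = mset0.
Proof. by rewrite /sumg big_set0. Qed.

Definition satO O : {set 'I_n} := [set i | gam i `<=` O].

Lemma satO_sub O C : O `<=` C -> satO O \subset satO C.
Proof. by move=> sOC; apply/subsetP => i; rewrite !inE => /msubset_trans; apply. Qed.

Lemma gam_sumg T i : i \in T -> gam i `<=` sumg T.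
Proof.
by move=> iT; apply/msubsetP => a; rewrite big_msetDE (bigD1 i) //= leq_addr.
Qed.

Lemma sub_satO T : T \subset satO (sumg T).
Proof. by apply/subsetP => i iT; rewrite inE gam_sumg. Qed.

Definition closed T := satO (sumg T) \subset T.

Lemma closed_satO T : closed T -> satO (sumg T) = T.
Proof. by move=> cT; apply/eqP; rewrite eqEsubset sub_satO andbT. Qed.

Definition uncontested O := sumg (satO O) `<=` O.

Lemma closed_uncontested O : uncontested O -> closed (satO O).
Proof. exact: satO_sub. Qed.

Definition goodf i O := (gam i `<=` O) && uncontested O.

Definition ftot f : {mset Res} := \big[msetD/mset0]_(i < n) f i.

Definition dev f i C : 'I_n -> {mset Res} := fun j => if j == i then C else f j.

Lemma ftot_dev f i C a : ftot (dev f i C) a + f i a = ftot f a + C a.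
Proof.
rewrite !big_msetDE !(bigD1 (P := predT) i) //= /dev eqxx.
under eq_bigr => j /negPf -> do [].
by lia.
Qed.

(** The last clause is the equilibrium condition for the members of [T]. The alternative [T = set0]
    admits the starting point, which need not be closed: the step for block 0, which contains no
    player, turns it into its closure. *)
Definition stage T f : Prop :=
  [/\ T = set0 \/ closed T, ftot f = sumg T, forall i, i \notin T -> f i = mset0,
      forall i, f i `<=` eps i
    & forall i C, i \in T -> C `<` f i -> ~~ goodf i (ftot (dev f i C))].

Lemma stage_ext T f f' : (forall i, f i = f' i) -> stage T f -> stage T f'.
Proof.
move=> E [H1 H2 H3 H4 H5]; split=> // [|i /H3||i C iT].
- by rewrite -H2; apply: eq_bigr => i _; rewrite E.
- by rewrite E.
- by move=> i; rewrite -E.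
rewrite -E => lt_C; have -> : ftot (dev f' i C) = ftot (dev f i C).
  by apply: eq_bigr => j _; rewrite /dev E.
exact: H5.
Qed.

(* Players are numbered from 1 here: [blk b] is empty when [b] is not such a
   number, in particular for [b = 0]. *)
Definition blk (b : nat) : {set 'I_n} := [set i : 'I_n | i.+1 == b].

Lemma blkS (i : 'I_n) : blk i.+1 = [set i].
Proof. by apply/setP => j; rewrite !inE eqSS. Qed.

Lemma blk0 : blk 0 = set0.
Proof. by apply/setP => j; rewrite !inE. Qed.

Lemma blkP b : blk b = set0 \/ exists i : 'I_n, b = i.+1.
Proof.
have [->|[i]] := set_0Vmem (blk b); first by left.
by rewrite inE => /eqP <-; right; exists i.
Qed.

Section Closure.

Variable L : nat.
Hypothesis ltnL : n < L.

(** Phrased with [blk b] instead of a player, so that the step is defined for every [b] below [L]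
    and idle when [b] numbers nobody. *)
Definition cstep T b := if sumg (blk b) `<=` sumg T then T :|: blk b else T.

Definition cround T := foldl cstep T (iota 0 L).

Definition clos T := iter L cround T.

Lemma cstep_infl T b : T \subset cstep T b.
Proof. by rewrite /cstep; case: ifP => // _; exact: subsetUl. Qed.

Lemma cround_infl T : T \subset cround T.
Proof. exact: foldl_inflationary cstep_infl _ _. Qed.

Lemma clos_infl T : T \subset clos T.
Proof. exact: iter_inflationary cround_infl. Qed.

Lemma blk_iota (i : 'I_n) : i.+1 \in iota 0 L.
Proof. by rewrite mem_iota /=; have := ltn_ord i; lia. Qed.

Lemma clos_closed T : closed (clos T).
Proof.
have E : cround (clos T) = clos T.
  by apply: iter_inflationary_fix cround_infl _; rewrite card_ord ltnW.
apply/subsetP => i; rewrite inE => le_i.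
have := foldl_inflationary_fix cstep_infl E (blk_iota i).
rewrite /cstep blkS /sumg big_set1 le_i => <-.
by rewrite !inE eqxx orbT.
Qed.

Lemma clos_min T U : T \subset U -> closed U -> clos T \subset U.
Proof.
move=> sTU cU; rewrite /clos; elim: L => //= m IH.
rewrite /cround; elim: iota (iter _ _ _) IH => //= b s IH W sWU; apply: IH.
rewrite /cstep; case: ifP => // le_b; rewrite subUset sWU /=.
apply/subsetP => i ib; apply: (subsetP cU); rewrite inE.
by apply: msubset_trans (gam_sumg ib) (msubset_trans le_b _); exact: sumg_sub.
Qed.

Lemma clos_id T : closed T -> clos T = T.
Proof. by move=> cT; apply/eqP; rewrite eqEsubset clos_infl clos_min. Qed.

Definition sume b : {mset Res} := \big[msetD/mset0]_(i in blk b) eps i.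

Definition ocond T b := sumg (clos (T :|: blk b) :\: T) `<=` sume b.

Definition ostep T b := if ocond T b then clos (T :|: blk b) else T.

Definition opass T := foldl ostep T (iota 0 L).

Lemma ostep_infl T b : T \subset ostep T b.
Proof.
rewrite /ostep; case: ifP => // _.
by apply: subset_trans (subsetUl _ _) (clos_infl _).
Qed.

Lemma opass_infl T : T \subset opass T.
Proof. exact: foldl_inflationary ostep_infl _ _. Qed.

Definition final := iter L opass set0.

Lemma final_stable b : b < L -> ostep final b = final.
Proof.
move=> lt_b; apply: (foldl_inflationary_fix ostep_infl (s := iota 0 L)).
  by apply: iter_inflationary_fix opass_infl _; rewrite card_ord ltnW.
by rewrite mem_iota.
Qed.

Lemma stage0 : stage set0 (fun=> mset0).
Proof.
split=> //; first by left.
- by apply/msetP => a; rewrite sumg0 mset0E big_msetDE big1 // => i _; rewrite mset0E.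
- by move=> i; exact: msub0set.
by move=> i C; rewrite inE.
Qed.

Lemma msetD_subl A B C : (A `+` B `<=` A `+` C) = (B `<=` C).
Proof. by apply/msubsetP/msubsetP => H a; have := H a; rewrite !msetE2 leq_add2l. Qed.

Lemma proper_mset0 C : (C `<` mset0) = false.
Proof. by rewrite mproperE msub0set andbF. Qed.

(* An old member [i] that could shrink its contribution now could already do
   so before: the new members are satisfied by what the newcomer adds. *)
Lemma stage_step T f b f' :
  stage T f -> ocond T b ->
  (forall i, f' i = f i `+`
     (if i \in blk b then sumg (clos (T :|: blk b) :\: T) else mset0)) ->
  stage (clos (T :|: blk b)) f'.
Proof.
move=> [T_cl f_tot f_out f_le f_min]; rewrite /ocond.
set T' := clos _; set D := sumg _ => D_le Ef'.
have T'_cl : closed T' by exact: clos_closed.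
have sTT' : T \subset T' by exact: subset_trans (subsetUl _ _) (clos_infl _).
have E_T' : sumg T' = sumg T `+` D by exact: sumg_split.
(* Here contributions do not change, while [T] may still gain players with empty goals; these
   contribute [mset0] and cannot give less. *)
have [D0|nzD] := eqVneq D mset0.
  have {}Ef' i : f' i = f i by rewrite Ef' D0 if_same msetD0.
  have Edev i C j : dev f' i C j = dev f i C j by rewrite /dev Ef'.
  split; [by right | | | |].
  - by rewrite E_T' D0 msetD0 -f_tot; apply: eq_bigr.
  - by move=> i iT'; rewrite Ef' f_out //; apply: contra iT'; exact: (subsetP sTT').
  - by move=> i; rewrite Ef'.
  move=> i C _; rewrite Ef' => lt_C; have [iT|/f_out E] := boolP (i \in T).
    have -> : ftot (dev f' i C) = ftot (dev f i C) by apply: eq_bigr.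
    exact: f_min.
  by rewrite E proper_mset0 in lt_C.
have [blk_b0|[i0 Eb]] := blkP b.
  case/negP: nzD; rewrite -msubset0.
  by move: D_le; rewrite /sume blk_b0 big_set0.
have Ebl : blk b = [set i0] by rewrite Eb blkS.
(* Otherwise [T :|: blk b] is the closed set [T], its own closure, and [D] would be empty. *)
have i0T : i0 \notin T.
  apply: contra nzD => i0T; case: T_cl => [T0|T_cl]; first by rewrite T0 inE in i0T.
  rewrite /D /T' Ebl (setUidPl _) ?sub1set // clos_id //.
  by rewrite setDv sumg0.
have E_i0 : f' i0 = D by rewrite Ef' Ebl inE eqxx f_out // mset0D.
have E_other i : i != i0 -> f' i = f i.
  by move=> /negPf ne; rewrite Ef' Ebl inE ne msetD0.
have Etot : ftot f' = ftot f `+` D.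
  apply/msetP => a; rewrite msetE2 [LHS]big_msetDE [ftot f a]big_msetDE (bigD1 i0) //= E_i0.
  rewrite [in RHS](bigD1 i0) //= f_out // mset0E addnC; congr (_ + _).
  by apply: eq_bigr => i /E_other ->.
split; [by right | by rewrite Etot f_tot E_T' | | |].
- move=> i iT'; have iT : i \notin T by apply: contra iT'; exact: (subsetP sTT').
  rewrite E_other ?f_out //; apply: contra iT' => /eqP ->.
  by apply: (subsetP (clos_infl _)); rewrite Ebl !inE eqxx orbT.
- move=> i; have [->|/E_other -> //] := eqVneq i i0.
  by rewrite E_i0; move: D_le; rewrite /sume Ebl big_set1.
move=> i C iT' lt_C; apply/negP => /andP[gam_le nc_O].
set O := ftot _ in gam_le nc_O.
have W_cl := closed_uncontested nc_O; set W := satO O in W_cl.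
have iW : i \in W by rewrite inE.
have [E|ne] := eqVneq i i0.
  have EO : O = sumg T `+` C.
    apply/msetP => a; have := ftot_dev f' i C a.
    by rewrite -/O Etot E E_i0 msetE2 f_tot msetE2 addnAC => /addIn.
  (* The newcomer gives [C] instead of [D]. Minimality of the closure forces all of [T'] to be
     satisfied; absence of contention then gives [D] below [C], against the strict decrease. *)
  have sT'W : T' \subset W.
    apply: clos_min W_cl; rewrite subUset Ebl sub1set -E iW andbT.
    apply: subset_trans (sub_satO T) (satO_sub _).
    by rewrite EO; apply/msubsetP => a; rewrite msetE2 leq_addr.
  have := msubset_trans (sumg_sub sT'W) nc_O.
  rewrite E_T' EO msetD_subl => le_DC.
  by move: lt_C; rewrite E E_i0 mproperE le_DC andbF.
have iT : i \in T.
  apply/negPn/negP => /f_out E; move: lt_C.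
  by rewrite E_other // E proper_mset0.
have {}T_cl : closed T by case: T_cl => // T0; rewrite T0 inE in iT.
have EO : O = ftot (dev f i C) `+` D.
  apply/msetP => a; have := ftot_dev f' i C a.
  by rewrite -/O Etot E_other // !msetE2 addnAC -(ftot_dev f i C a) addnAC => /addIn.
rewrite E_other // in lt_C.
have sWD : T' :\: T \subset W.
  apply: subset_trans (sub_satO _) (satO_sub _).
  by rewrite EO; apply/msubsetP => a; rewrite msetE2 leq_addl.
(* The part [D] of the outcome is consumed exactly by the goals of [T' :\: T], so it cancels,
   leaving a bound on the outcome that the same deviation had before the step. *)
have le_WT : sumg (W :&: T) `<=` ftot (dev f i C).
  have sU : (W :&: T) \subset (W :&: T) :|: (T' :\: T) by exact: subsetUl.
  have le_U : sumg ((W :&: T) :|: (T' :\: T)) `<=` O.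
    by apply: msubset_trans nc_O; apply: sumg_sub; rewrite subUset subsetIl.
  have ED : ((W :&: T) :|: (T' :\: T)) :\: (W :&: T) = T' :\: T.
    by apply/setP => j; rewrite !inE; case: (j \in T); rewrite ?andbF ?andbT ?orbF ?andNb.
  rewrite (sumg_split sU) ED EO in le_U.
  by move: le_U; rewrite msetDC [X in _ `<=` X]msetDC msetD_subl.
have /negP[] := f_min _ _ iT lt_C; rewrite /goodf.
have le_tot : ftot (dev f i C) `<=` sumg T.
  rewrite -f_tot; apply/msubsetP => a.
  by rewrite -(leq_add2r (f i a)) ftot_dev leq_add2l (msubsetP (mproper_sub lt_C)).
apply/andP; split.
  by apply: msubset_trans le_WT; apply: gam_sumg; rewrite inE iW.
(* Whoever the earlier deviation satisfies lies in [W], since that outcome is below [O], and in [T],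
   since it is below [sumg T] and [T] is closed. *)
apply: msubset_trans (sumg_sub _) le_WT; rewrite subsetI; apply/andP; split.
  by apply: satO_sub; rewrite EO; apply/msubsetP => a; rewrite msetE2 leq_addr.
by apply: subset_trans (satO_sub le_tot) T_cl.
Qed.

Definition preff i O C O' C' :=
  [|| [&& ~~ goodf i O, ~~ goodf i O' & C `<` C'],
      goodf i O && ~~ goodf i O' | [&& goodf i O, goodf i O' & C `<` C']].

(** Members of [T] are already good and cannot give less. An outsider gives nothing, so its only
    possible gain is to become good, and this would make [ocond] true for it. *)
Lemma stable_NE T f i C :
  stage T f -> (forall b, b < L -> ostep T b = T) -> C `<=` eps i ->
  ~~ preff i (ftot (dev f i C)) C (ftot f) (f i).
Proof.
move=> [T_cl f_tot f_out f_le f_min] T_st C_le.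
have {}T_cl : closed T.
  (* Block 0 is empty, and the closure of the empty set costs nothing because its members have empty
     goals; stability at [b = 0] therefore makes [T] closed. *)
  case: T_cl => // T0; have := T_st 0 (leq_trans _ ltnL); rewrite /ostep.
  have -> : ocond T 0.
    rewrite /ocond blk0 T0 setU0 setD0.
    have sE : clos set0 \subset [set i | gam i == mset0].
      apply: clos_min (sub0set _) _; apply/subsetP => j; rewrite !inE => le_j.
      rewrite -msubset0; apply: msubset_trans le_j _; apply/msubsetP => a.
      by rewrite big_msetDE big1 // => u; rewrite inE => /eqP ->; rewrite mset0E.
    apply/msubsetP => a; rewrite big_msetDE big1 // => u /(subsetP sE).
    by rewrite inE => /eqP ->; rewrite mset0E.
  by move=> /(_ isT) <-; exact: clos_closed.
have good_f : goodf i (ftot f) = (i \in T).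
  rewrite /goodf f_tot /uncontested closed_satO // msubset_refl andbT.
  by rewrite -{2}(closed_satO T_cl) inE.
rewrite /preff good_f; have [iT|iT] := boolP (i \in T).
  rewrite /= !andbF /=; apply/negP => /andP[gd lt_C].
  by have /negP[] := f_min _ _ iT lt_C.
rewrite f_out // proper_mset0 !andbF andbT orbF /=.
apply/negP => /andP[gam_le nc_O]; set O := ftot _ in gam_le nc_O.
have EO : O = sumg T `+` C.
  apply/msetP => a; have := ftot_dev f i C a.
  by rewrite -/O f_tot f_out // msetE2 mset0E addn0.
have W_cl := closed_uncontested nc_O.
have sT'W : clos (T :|: blk i.+1) \subset satO O.
  apply: clos_min W_cl; rewrite subUset blkS sub1set inE gam_le andbT.
  apply: subset_trans (sub_satO T) (satO_sub _).
  by rewrite EO; apply/msubsetP => a; rewrite msetE2 leq_addr.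
(* Contention-freeness bounds the goals of the closure by [sumg T] plus [C]; cancelling [sumg T]
   shows that [C], hence the endowment, covers the rest. *)
have : ocond T i.+1.
  rewrite /ocond /sume {2}blkS big_set1; apply: msubset_trans C_le.
  rewrite -(msetD_subl (sumg T)) -sumg_split; last first.
    exact: subset_trans (subsetUl _ _) (clos_infl _).
  by rewrite -EO; apply: msubset_trans (sumg_sub sT'W) nc_O.
have := T_st i.+1; rewrite /ostep => /[swap] ->.
move=> E; case/negP: iT; rewrite -E; last by have := ltn_ord i; lia.
by apply: (subsetP (clos_infl _)); rewrite blkS !inE eqxx orbT.
Qed.

End Closure.

End FlatGame.

(** * Atomic bags as multisets of atoms *)

Section Bags.

Variable Res : choiceType.

Implicit Types (X Y : {mset {mset Res}}).

Definition atomic X : Prop := forall B, B \in X -> exists a : Res, B = [mset a].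

Lemma flat_bagE X a : flat_bag X a = \sum_(B <- X) (B : {mset Res}) a.
Proof. exact: big_msetDE. Qed.

Lemma flat_bagD X Y : flat_bag (X `+` Y) = flat_bag X `+` flat_bag Y.
Proof.
apply/msetP => a; rewrite msetE2 !flat_bagE -big_cat.
apply: perm_big; apply/allP => B _ /=.
by rewrite count_cat !count_mem_mset msetE2.
Qed.

Lemma flat_bag0 : flat_bag (mset0 : {mset {mset Res}}) = mset0.
Proof. by rewrite /flat_bag big_mset0. Qed.

Lemma mset1_inj : injective (fun a : Res => [mset a]).
Proof. exact: msetn_inj. Qed.

Lemma flat_bag_atomic X a : atomic X -> flat_bag X a = X [mset a].
Proof.
move=> atX; rewrite flat_bagE -count_mem_mset -sum1_count [RHS]big_mkcond.
apply: eq_big_seq => B /atX[b ->]; rewrite msetnE /= (inj_eq mset1_inj) eq_sym.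
by case: eqP.
Qed.

Lemma atomic_sub X Y : X `<=` Y -> atomic Y -> atomic X.
Proof. by move=> sXY atY B /(msubset_subset sXY)/atY. Qed.

(** For atomic bags the multiplicity of [a] after flattening is that of [[mset a]] before. Grouping
    several atoms in one bundle would break the implication from left to right. *)
Lemma flat_bag_sub X Y :
  atomic X -> atomic Y -> (flat_bag X `<=` flat_bag Y) = (X `<=` Y).
Proof.
move=> atX atY; apply/msubsetP/msubsetP => H.
  move=> B; have [/atX[a ->]|/mset_eq0P -> //] := boolP (B \in X).
  by have := H a; rewrite !flat_bag_atomic.
by move=> a; rewrite !flat_bag_atomic.
Qed.

Lemma flat_bag_proper X Y :
  atomic X -> atomic Y -> (flat_bag X `<` flat_bag Y) = (X `<` Y).
Proof. by move=> atX atY; rewrite !mproperE !flat_bag_sub. Qed.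

Definition singles (s : seq Res) : {mset {mset Res}} :=
  seq_mset [seq [mset a] | a <- s].

Lemma singles_atomic s : atomic (singles s).
Proof.
move=> C; rewrite -mset_gt0 mset_seqE -has_count has_pred1.
by case/mapP => a _ ->; exists a.
Qed.

Lemma flat_singles s a : flat_bag (singles s) a = count_mem a s.
Proof.
rewrite (flat_bag_atomic _ (@singles_atomic s)) mset_seqE count_map.
by apply: eq_count => b /=; exact: (inj_eq mset1_inj).
Qed.

Section Game.

Variable G : rcg Res.
Hypothesis G_bar : rcgbar G.

Definition eps_flat (i : 'I_(nplayers G)) : {mset Res} := flat_bag (endowment i).

Definition flats (P : profile G) (i : 'I_(nplayers G)) : {mset Res} := flat_bag (P i).

Lemma flat_outcome (P : profile G) : flat_bag (outcome P) = ftot (flats P).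
Proof. exact: (big_morph _ flat_bagD flat_bag0). Qed.

Lemma good_pcaE (P : profile G) i :
  good_pca i P = goodf (@goal _ G) i (ftot (flats P)).
Proof.
rewrite /good_pca /contentious negbK /pot_satisfied /transforms flat_outcome.
congr (_ && _); rewrite /uncontested /sumg; congr (_ `<=` _).
by apply: eq_bigl => j; rewrite inE.
Qed.

Lemma flats_deviate (P : profile G) i C :
  ftot (flats (deviate P i C)) = ftot (dev (flats P) i (flat_bag C)).
Proof. by apply: eq_bigr => j _; rewrite /flats /dev ffunE; case: ifP. Qed.

Lemma stage_NE L (T : {set 'I_(nplayers G)}) (P : profile G) :
  nplayers G < L -> is_profile P -> stage (@goal _ G) eps_flat T (flats P) ->
  (forall b, b < L -> ostep (@goal _ G) eps_flat L T b = T) -> NE_pca P.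
Proof.
move=> lt_L prP T_inv T_st; split=> // -[i [C [C_le]]].
have at_e : atomic (endowment i) by exact: G_bar.
have at_C := atomic_sub C_le at_e; have at_P := atomic_sub (prP i) at_e.
have C_le' : flat_bag C `<=` eps_flat i by rewrite flat_bag_sub.
have := stable_NE lt_L T_inv T_st C_le'.
rewrite /preff /prefers_pca !good_pcaE flats_deviate ffunE eqxx.
by rewrite -(flat_bag_proper at_C at_P) => /negP.
Qed.

(** The same iteration as the one run by the machine, with the smallest admissible number of rounds
    in place of the input length. *)
Lemma NE_exists : exists P : profile G, NE_pca P.
Proof.
pose L := (nplayers G).+1.
pose step := ostep (@goal _ G) eps_flat L.
have [f f_inv] : exists f, stage (@goal _ G) eps_flat
    (final (@goal _ G) eps_flat L) f.
  (* Only the outer occurrence of [L] is generalized: the number of passes varies, while the length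
     of each pass and of the closures stays fixed. *)
  rewrite /final; elim: {1}L => [|m [f IH]]; first by eexists; exact: stage0.
  rewrite iterS; move: (iter m _ _) IH => T.
  rewrite /opass; elim: (iota 0 L) T f => [|b s IHs] T f T_inv; first by exists f.
  rewrite /=; have [c|c] := boolP (ocond (@goal _ G) eps_flat L T b).
    apply: IHs; rewrite /ostep c.
    by apply: stage_step; [exact: ltnSn | exact: T_inv | | move=> i; reflexivity].
  by rewrite {2}/ostep (negPf c); exact: IHs T_inv.
exists [ffun i => singles (f i)].
have E i : flats [ffun i => singles (f i)] i = f i.
  by apply/msetP => a; rewrite /flats ffunE flat_singles count_mem_mset.
have prP : is_profile ([ffun i => singles (f i)] : profile G).
  move=> i; rewrite /is_choice -flat_bag_sub; last exact: G_bar.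
    by have := E i; rewrite /flats => ->; case: f_inv.
  by rewrite ffunE; exact: singles_atomic.
apply: stage_NE (ltnSn _) prP _ (@final_stable _ _ _ _ L (ltnSn _)).
by apply: stage_ext f_inv => i; rewrite E.
Qed.

End Game.

End Bags.

(** * The program *)

(* States of the automaton that reads the encoding of a game.  [T], [G] and
   [B] refer to the list of types, a goal and an endowment; the other letters
   to the top level ([P]) and to one player ([Q]). *)
Inductive phase :=
  P0 | P1 | T0 | T1 | P2 | P3 | Q0 | G0 | G1 | Q1 | B0 | B1 | B2 | Q2 | PE.

Definition phase_code (q : phase) : 'I_15 :=
  match q with
  | P0 => inord 0 | P1 => inord 1 | T0 => inord 2 | T1 => inord 3 | P2 => inord 4
  | P3 => inord 5 | Q0 => inord 6 | G0 => inord 7 | G1 => inord 8 | Q1 => inord 9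
  | B0 => inord 10 | B1 => inord 11 | B2 => inord 12 | Q2 => inord 13
  | PE => inord 14
  end.

Definition phase_decode (i : 'I_15) : phase :=
  nth PE [:: P0; P1; T0; T1; P2; P3; Q0; G0; G1; Q1; B0; B1; B2; Q2; PE] i.

Lemma phase_codeK : cancel phase_code phase_decode.
Proof. by case; rewrite /phase_decode /= inordK. Qed.

HB.instance Definition _ := Finite.copy phase (can_type phase_codeK).

(** The grammar is that of atomic endowments, each bundle holding a single instance. [PE] is both
    the phase after the list of players and the sink for malformed words. *)
Definition delta (q : phase) (s : symbol) : phase :=
  match q, s with
  | P0, Open => P1 | P1, Open => T0 | T0, Open => T1 | T0, Close => P2
  | T1, Bit _ => T1 | T1, Close => T0 | P2, Open => P3 | P3, Open => Q0
  | P3, Close => PE | Q0, Open => G0 | G0, Open => G1 | G0, Close => Q1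
  | G1, Bit _ => G1 | G1, Close => G0 | Q1, Open => B0 | B0, Open => B1
  | B0, Close => Q2 | B1, Open => B2 | B1, Close => B0 | B2, Bit _ => B2
  | B2, Close => B1 | Q2, Close => P3 | _, _ => PE
  end.

Definition isP q s := if (q, s) is (P3, Open) then true else false.
Definition isG q s := if (q, s) is (G0, Open) then true else false.
Definition isE q s := if (q, s) is (B1, Open) then true else false.

(* [sy], [ph], [hd]: symbol, phase in which it is read, and whether it precedes
   the first player.  On the first tape, [tT] marks the blocks of the current
   set of players, [tU] those of the set that is being closed, [tB] that of the
   candidate, [tC] that of the player whose goal is tested, [tP] the instances
   contributed so far and [tK] the symbols of the output.  On the second tape,
   [tZ] marks the instances available for a matching and [tM] those used. *)
Record rcell := RCell {
  sy : symbol; ph : phase; hd : bool; tT : bool; tU : bool; tB : bool; tC : bool;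
  tP : bool; tK : bool; tZ : bool; tM : bool }.

Definition rcell_code (r : rcell) :=
  (sy r, ph r, hd r, tT r, tU r, tB r, tC r, tP r, tK r, tZ r, tM r).

Definition rcell_decode x : rcell :=
  let: (a, b, c, d, e, f, g, h, i, j, k) := x in RCell a b c d e f g h i j k.

Lemma rcell_codeK : cancel rcell_code rcell_decode.
Proof. by case. Qed.

HB.instance Definition _ := Finite.copy rcell (can_type rcell_codeK).

Definition setT v (r : rcell) :=
  let: RCell a b c d e f g h i j k := r in RCell a b c v e f g h i j k.
Definition setU v (r : rcell) :=
  let: RCell a b c d e f g h i j k := r in RCell a b c d v f g h i j k.
Definition setB v (r : rcell) :=
  let: RCell a b c d e f g h i j k := r in RCell a b c d e v g h i j k.
Definition setC v (r : rcell) :=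
  let: RCell a b c d e f g h i j k := r in RCell a b c d e f v h i j k.
Definition setP v (r : rcell) :=
  let: RCell a b c d e f g h i j k := r in RCell a b c d e f g v i j k.
Definition setK v (r : rcell) :=
  let: RCell a b c d e f g h i j k := r in RCell a b c d e f g h v j k.
Definition setZ v (r : rcell) :=
  let: RCell a b c d e f g h i j k := r in RCell a b c d e f g h i v k.
Definition setM v (r : rcell) :=
  let: RCell a b c d e f g h i j k := r in RCell a b c d e f g h i j v.

Definition ini (s : symbol) : rcell :=
  RCell s P0 false false false false false false false false false.

(* [fq], [fh]: phase, and whether no player has been met yet; [fe], [fr]:
   equality test, and whether it is still running; [fk], [ff]: outcome of a
   matching, and whether the current instance has found its match; [f1],
   [f2]: registers of the transducers. *)
Record flags := Flags {
  fq : phase; fh : bool; fe : bool; fr : bool; fk : bool; ff : bool;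
  f1 : bool; f2 : bool }.

Definition flags_code (a : flags) :=
  (fq a, fh a, fe a, fr a, fk a, ff a, f1 a, f2 a).

Definition flags_decode x : flags :=
  let: (a, b, c, d, e, f, g, h) := x in Flags a b c d e f g h.

Lemma flags_codeK : cancel flags_code flags_decode.
Proof. by case. Qed.

HB.instance Definition _ := Finite.copy flags (can_type flags_codeK).

Definition setQH q v (r : flags) :=
  let: Flags a b c d e f g h := r in Flags q v c d e f g h.
Definition setE v u (r : flags) :=
  let: Flags a b c d e f g h := r in Flags a b v u e f g h.
Definition setOk v (r : flags) :=
  let: Flags a b c d e f g h := r in Flags a b c d v f g h.
Definition setFound v (r : flags) :=
  let: Flags a b c d e f g h := r in Flags a b c d e v g h.
Definition set12 v u (r : flags) :=
  let: Flags a b c d e f g h := r in Flags a b c d e f v u.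

Definition flags0 := Flags P0 true false false false false false false.

Local Notation prg := (prog symbol flags rcell 6).
Local Notation tape_ix := 'I_7.
Local Notation cells := {ffun tape_ix -> option rcell}.
Local Notation state := (store symbol flags rcell 6).

(** Two tapes carry data, so that two places of the input can be compared. The others are clocks:
    [t2] for comparisons, [t3] and [t4] for the search, [t5] and [t6] for the closure. *)
Definition t0 : tape_ix := @Ordinal 7 0 isT.
Definition t1 : tape_ix := @Ordinal 7 1 isT.
Definition t2 : tape_ix := @Ordinal 7 2 isT.
Definition t3 : tape_ix := @Ordinal 7 3 isT.
Definition t4 : tape_ix := @Ordinal 7 4 isT.
Definition t5 : tape_ix := @Ordinal 7 5 isT.
Definition t6 : tape_ix := @Ordinal 7 6 isT.

Definition skip : prg := Skip _ _ _ _.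

Definition rd (c : cells) (i : tape_ix) : rcell := odflt (ini Open) (c i).

(** Clock tapes receive [y] as well, which is harmless: only the blanks at their ends are ever
    used. *)
Definition upd2 (f : flags -> rcell -> rcell -> flags * rcell * rcell) : prg :=
  Upd (fun a c => let: (a', x, y) := f a (rd c t0) (rd c t1) in
       (a', fun i => if i == t0 then x else y, None)).

Definition updf (g : flags -> flags) : prg := Upd (fun a c => (g a, rd c, None)).

Definition rep_loop (c : tape_ix) (p : prg) : prg := Sweep c [::] p skip.

Definition scan f : prg := Sweep t0 [:: t1] (upd2 f) skip.

Definition map0 (g : rcell -> rcell -> rcell) : prg :=
  scan (fun a x y => (a, g x y, y)).

Definition map1 (g : rcell -> rcell -> rcell) : prg :=
  scan (fun a x y => (a, x, g x y)).

Definition parse : prg :=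
  scan (fun a x y =>
    let q := fq a in let h := fh a && ~~ isP q (sy x) in
    (setQH (delta q (sy x)) h a,
     RCell (sy x) q h false false false false false false false false, y)).

(** Shifts a mark from one player's block to the next. [f1] and [f2] hold the old and the new mark
    of the preceding cell: the first cell of a block inherits the old one, any other cell the new
    one. *)
Definition adv (get : rcell -> bool) (set : bool -> rcell -> rcell) : prg :=
  Seq (updf (set12 false false))
      (scan (fun a x y =>
         let i := if isP (ph x) (sy x) then f1 a else f2 a in
         (set12 (get x) i a, set i x, y))).

Definition prep (z : rcell -> bool) : prg :=
  map1 (fun x y => setZ (z x) (setM false y)).

Definition eq_step (a : flags) (x y : option rcell) : flags :=
  if fr a then
    if (x, y) is (Some x', Some y') then
      if sy x' == sy y' then (if sy x' == Close then setE (fe a) false a else a)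
      else setE false false a
    else setE false false a
  else a.

Definition eq_prog : prg :=
  Seq (updf (setE true true))
      (Sweep t2 [:: t0; t1]
         (Upd (fun a c => (eq_step a (c t0) (c t1), rd c, None))) skip).

Definition try_match : prg :=
  If (fun a c => [&& ~~ ff a, tZ (rd c t1) & ~~ tM (rd c t1)])
     (Seq eq_prog
          (Upd (fun a c =>
            (setFound (fe a) a,
             fun i => if i == t1 then setM (fe a) (rd c t1) else rd c i, None))))
     skip.

Definition match_one : prg :=
  Seq (updf (setFound false))
      (Seq (Sweep t1 [::] try_match skip) (updf (fun a => setOk (fk a && ff a) a))).

Definition match_prog (yp : rcell -> bool) : prg :=
  Seq (updf (setOk true))
      (Sweep t0 [::] (If (fun a c => yp (rd c t0)) match_one skip) skip).

Definition cell_isG r := isG (ph r) (sy r).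
Definition cell_isE r := isE (ph r) (sy r).

Definition if_ok (p : prg) : prg := If (fun a _ => fk a) p skip.

Definition closure_body : prg :=
  Seq (prep (fun x => cell_isG x && tU x))
  (Seq (match_prog (fun x => cell_isG x && tC x))
  (Seq (if_ok (map0 (fun x _ => setU (tU x || tC x) x)))
       (adv tC setC))).

Definition closure_prog : prg :=
  rep_loop t5
    (Seq (map0 (fun x _ => setC (hd x) x)) (rep_loop t6 closure_body)).

Definition candidate_body : prg :=
  Seq (map0 (fun x _ => setU (tT x || tB x) x))
  (Seq closure_prog
  (Seq (prep (fun x => cell_isE x && tB x))
  (Seq (match_prog (fun x => [&& cell_isG x, tU x & ~~ tT x]))
  (Seq (if_ok (map0 (fun x y => setP (tP x || tM y) (setT (tU x) x))))
       (adv tB setB))))).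

Definition search_prog : prg :=
  rep_loop t3
    (Seq (map0 (fun x _ => setB (hd x) x)) (rep_loop t4 candidate_body)).

(** The encoded profile arises from the input by erasing the types, the goals, the brackets around
    players and the unselected bundles. The flag [f] remembers the mark [p] found at the opening
    bracket of the current instance. *)
Definition keep_step (f : bool) (q : phase) (s : symbol) (p : bool) : bool * bool :=
  match q, s with
  | B1, Open => (p, p)
  | B2, _ | B1, Close => (f, f)
  | P2, Open | P3, Close | Q1, Open | B0, Close => (f, true)
  | _, _ => (f, false)
  end.

(* The opening bracket of a bundle is emitted iff the next symbol is, which is
   known since the emission proceeds from right to left. *)
Definition emit_prog : prg :=
  Seq (scan (fun a x y =>
         let: (f, k) := keep_step (f1 a) (ph x) (sy x) (tP x) in
         (set12 f false a, setK k x, y)))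
      (Sweep t0 [::] skip
        (Upd (fun a c =>
          let x := rd c t0 in
          let k := if (ph x, sy x) is (B0, Open) then f1 a else tK x in
          (set12 k false a, rd c, if k then Some (sy x) else None)))).

Definition main_prog : prg := Seq parse (Seq search_prog emit_prog).

Lemma main_prog_wf : wfp [::] main_prog.
Proof. by []. Qed.

Lemma foldl_const (T X : Type) (x : T) (l : seq X) : foldl (fun s _ => s) x l = x.
Proof. by elim: l. Qed.

Lemma foldl_iotaS (T : Type) (f : T -> nat -> T) x m :
  foldl f x (iota 0 m.+1) = f (foldl f x (iota 0 m)) m.
Proof. by rewrite -(addn1 m) iotaD foldl_cat. Qed.

Section Scans.

Variable L : nat.

Implicit Types (s : state) (h : tape_ix -> nat).

Definition cell0 s := arr s t0.
Definition cell1 s := arr s t1.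

Lemma exec_rep c p h s :
  exec L (rep_loop c p) h s = foldl (fun s j => exec L p (shift [:: c] h j) s) s (iota 0 L).
Proof. exact: foldl_const. Qed.

Lemma rep_ind (I : nat -> state -> Prop) c p h s :
  c != t0 -> c != t1 -> h t0 = 0 -> h t1 = 0 ->
  I 0 s ->
  (forall j s h, j < L -> h t0 = 0 -> h t1 = 0 -> I j s -> I j.+1 (exec L p h s)) ->
  I L (exec L (rep_loop c p) h s).
Proof.
move=> c0 c1 h0 h1 I0 Istep; rewrite exec_rep.
suff: forall m, m <= L ->
  I m (foldl (fun s j => exec L p (shift [:: c] h j) s) s (iota 0 m)) by apply.
elim=> // m IH lt_m; rewrite foldl_iotaS /=.
apply: Istep (IH (ltnW lt_m)) => //.
- by rewrite /shift inE eq_sym (negPf c0) h0.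
- by rewrite /shift inE eq_sym (negPf c1) h1.
Qed.

Fixpoint scan_flags (f : flags -> rcell -> rcell -> flags * rcell * rcell) a
    (X Y : nat -> rcell) m : flags :=
  if m is m'.+1 then (f (scan_flags f a X Y m') (X m') (Y m')).1.1 else a.

(** Step [j] touches only cell [j] of the data tapes, so the final contents are pointwise in the
    initial ones, given the flags on arrival. *)
Lemma exec_scan f h s : h t0 = 0 -> h t1 = 0 ->
  let s' := exec L (scan f) h s in
  let a := scan_flags f (fl s) (cell0 s) (cell1 s) in
  [/\ fl s' = a L,
      forall x, x < L -> cell0 s' x = (f (a x) (cell0 s x) (cell1 s x)).1.2,
      forall x, x < L -> cell1 s' x = (f (a x) (cell0 s x) (cell1 s x)).2
    & out s' = out s].
Proof.
move=> h0 h1 s' a.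
have -> : s' = foldl (fun s j => exec L (upd2 f) (shift [:: t0; t1] h j) s) s (iota 0 L).
  exact: foldl_const.
suff: forall m, m <= L ->
  let s' := foldl (fun s j => exec L (upd2 f) (shift [:: t0; t1] h j) s) s (iota 0 m) in
  [/\ fl s' = a m,
      forall x, cell0 s' x = if x < m then (f (a x) (cell0 s x) (cell1 s x)).1.2 else cell0 s x,
      forall x, cell1 s' x = if x < m then (f (a x) (cell0 s x) (cell1 s x)).2 else cell1 s x
    & out s' = out s].
  move=> /(_ L (leqnn L)) [Ef EA EB Eo]; split=> // x lt_x.
    by rewrite EA lt_x.
  by rewrite EB lt_x.
elim=> [|m IH] le_m; first by split.
rewrite foldl_iotaS /=.
have [Ef EA EB Eo] := IH (ltnW le_m); set s1 := foldl _ s _ in Ef EA EB Eo *.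
have Es0 : shift [:: t0; t1] h m t0 = m by rewrite /shift h0.
have Es1 : shift [:: t0; t1] h m t1 = m by rewrite /shift h1.
rewrite /rd !ffunE Es0 Es1 le_m /= -/(cell0 s1) -/(cell1 s1) EA EB ltnn Ef.
case E : (f _ _ _) => [[a' x'] y'] /=; split; rewrite /cell0 /cell1 /= ?Es0 ?Es1 ?E //.
- by rewrite -[a m.+1]/((f (a m) (cell0 s m) (cell1 s m)).1.1) E.
- by move=> x; rewrite ltnS -/(cell0 s1) EA; case: ltngtP => // ->; rewrite E.
- by move=> x; rewrite ltnS -/(cell1 s1) EB; case: ltngtP => // ->; rewrite E.
Qed.

End Scans.

(** * Matching *)

Fixpoint bits_of (u : seq symbol) : seq bool :=
  if u is Bit b :: u' then b :: bits_of u' else [::].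

Section Positions.

Variable w : seq symbol.

Local Notation L := (size w).

Definition syx x := nth Close w x.
Definition phs x := foldl delta P0 (take x w).
Definition isPx x := isP (phs x) (syx x).
Definition isGx x := isG (phs x) (syx x).
Definition isEx x := isE (phs x) (syx x).
(* The positions that precede the first player get [0], and those of player
   [i] get [i + 1]. *)
Definition own x := count isPx (iota 0 x.+1).
Definition key x := bits_of (drop x.+1 w).
Definition wf_inst x := exists r, drop x w = Open :: map Bit (key x) ++ Close :: r.
Definition cnt (p : pred nat) m k := count (fun x => p x && (key x == k)) (iota 0 m).

Definition eq_stepS (a : flags) (x y : option symbol) : flags :=
  if fr a then
    if (x, y) is (Some x', Some y') then
      if x' == y' then (if x' == Close then setE (fe a) false a else a)
      else setE false false a
    else setE false false a
  else a.

Lemma eq_stepE a x y : eq_step a x y = eq_stepS a (omap sy x) (omap sy y).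
Proof. by case: x y => [x|] [y|]. Qed.

Lemma eq_run_stop a m u v :
  fr a = false ->
  foldl (fun a k => eq_stepS a (onth u k) (onth v k)) a (iota 0 m) = a.
Proof. by move=> fa; elim: (iota 0 m) => //= k l IH; rewrite {2}/eq_stepS fa. Qed.

Lemma setE_fr e r a : fr (setE e r a) = r. Proof. by case: a. Qed.

(** A bit string followed by [Close] is a prefix-free code: a mismatch or a common [Close] occurs
    within [(size k1).+1] symbols and freezes the verdict. *)
Lemma eq_run k1 k2 r1 r2 m a :
  fr a -> size k1 < m ->
  foldl (fun a k => eq_stepS a (onth (map Bit k1 ++ Close :: r1) k)
                               (onth (map Bit k2 ++ Close :: r2) k)) a (iota 0 m)
  = setE (fe a && (k1 == k2)) false a.
Proof.
elim: m k1 k2 => // m IH k1 k2 ra lt_m.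
have Eiota : iota 0 m.+1 = 0 :: map S (iota 0 m) by rewrite /= -[1]addn0 iotaDl.
rewrite Eiota /=; set a1 := eq_stepS _ _ _.
set g := (X in foldl X).
have Eg b l : foldl g b (map S l) =
  foldl (fun a k => eq_stepS a (onth (behead (map Bit k1 ++ Close :: r1)) k)
                               (onth (behead (map Bit k2 ++ Close :: r2)) k)) b l.
  elim: l b => //= k l IHl b; rewrite IHl; congr (foldl _ _ _).
  by rewrite /g; case: (k1) (k2) => [|? ?] [|? ?].
rewrite {}Eg {g Eiota}.
case: k1 k2 lt_m @a1 => [|b1 k1] [|b2 k2] /= lt_m; rewrite /eq_stepS ra /=.
- by rewrite eq_run_stop ?setE_fr // eqxx andbT.
- by rewrite eq_run_stop ?setE_fr // andbF.
- by rewrite eq_run_stop ?setE_fr // andbF.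
rewrite eqseq_cons; have -> : (Bit b1 == Bit b2) = (b1 == b2) by apply/eqP/eqP => [[]|->].
case: eqP => _ /=; last by rewrite eq_run_stop ?setE_fr // andbF.
by rewrite IH.
Qed.

Implicit Types (s : state) (h : tape_ix -> nat).

Definition sy_ok s : Prop :=
  forall x, x < L -> sy (cell0 s x) = syx x /\ sy (cell1 s x) = syx x.

Lemma wfk_lt x : wf_inst x -> x + (size (key x)).+1 < L.
Proof.
move=> [r E]; have := congr1 size E.
by rewrite size_drop /= size_cat size_map /=; lia.
Qed.

Lemma exec_eq h s : wf_inst (h t0) -> wf_inst (h t1) -> sy_ok s ->
  let s' := exec L eq_prog h s in
  [/\ exists r, fl s' = setE (key (h t0) == key (h t1)) r (fl s),
      forall x, x < L -> cell0 s' x = cell0 s x,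
      forall x, x < L -> cell1 s' x = cell1 s x
    & out s' = out s].
Proof.
set x := h t0; set y := h t1 => wx wy sy_s s'.
pose a0 := setE true true (fl s).
pose run m := foldl (fun a k => eq_stepS a (onth (drop x w) k) (onth (drop y w) k)) a0 (iota 0 m).
pose s1 := exec L (updf (setE true true)) h s.
pose body := Upd (fun a (c : cells) => (eq_step a (c t0) (c t1), rd c, None)) : prg.
have -> : s' = foldl (fun s j => exec L body (shift [:: t2; t0; t1] h j) s) s1 (iota 0 L).
  exact: foldl_const.
have E1 i z : z < L -> arr s1 i z = arr s i z.
  move=> lt_z; rewrite /= /rd ffunE; case: eqP => // <-.
  by rewrite lt_z.
have inv m : m <= L ->
  let s' := foldl (fun s j => exec L body (shift [:: t2; t0; t1] h j) s) s1 (iota 0 m) in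
  [/\ fl s' = run m, forall i z, z < L -> arr s' i z = arr s i z & out s' = out s].
  elim: m => [|m IH] le_m; first by split=> // i z /E1.
  rewrite foldl_iotaS /=.
  have [Ef EA Eo] := IH (ltnW le_m); set s2 := foldl _ s1 _ in Ef EA Eo *.
  rewrite Ef Eo; split=> // [|i z lt_z].
    rewrite eq_stepE /run -(addn1 m) iotaD foldl_cat /= add0n.
    congr (eq_stepS _ _ _); rewrite ffunE /shift !inE /= -/x -/y -[LHS]/(omap sy _).
      case: ltnP => [lt|le] /=; last by rewrite onth_default // size_drop; lia.
      rewrite EA // -/(cell0 s _) (sy_s _ lt).1 /syx -nth_drop.
      by rewrite onthE (nth_map Close) // size_drop; lia.
    case: ltnP => [lt|le] /=; last by rewrite onth_default // size_drop; lia.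
    rewrite EA // -/(cell1 s _) (sy_s _ lt).2 /syx -nth_drop.
    by rewrite onthE (nth_map Close) // size_drop; lia.
  rewrite /rd ffunE; case: eqP => [Ez|_]; last exact: EA.
  by rewrite -Ez lt_z /= EA.
have [Ef EA Eo] := inv L (leqnn L); set s2 := foldl _ _ _ in Ef EA Eo *.
split=> // [|z|z]; [| exact: EA | exact: EA].
exists false; rewrite Ef /run; have := wfk_lt wx.
have [[r1 ->] [r2 ->]] := (wx, wy) => lt_x.
have -> : iota 0 L = 0 :: map S (iota 0 L.-1).
  by case: (L) lt_x => [|l] //= _; rewrite -[1]addn0 iotaDl.
rewrite /=; set a1 := eq_stepS a0 _ _.
(* The first pair of symbols is the two opening brackets, which agree. *)
have -> : a1 = a0 by rewrite /a1 /a0 /eq_stepS setE_fr.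
set g := (X in foldl X).
have Eg b l : foldl g b (map S l) =
  foldl (fun a k => eq_stepS a (onth (map Bit (key x) ++ Close :: r1) k)
                               (onth (map Bit (key y) ++ Close :: r2) k)) b l.
  by elim: l b => //= k l IHl b; rewrite IHl.
rewrite {}Eg eq_run; first by rewrite /a0; case: (fl s).
  by rewrite setE_fr.
by lia.
Qed.

(** What a matching leaves alone: everything on the data tapes except the marks [tM] of the second
    one. *)
Definition frame s s' : Prop :=
  [/\ forall x, x < L -> cell0 s' x = cell0 s x,
      forall y, y < L -> cell1 s' y = setM (tM (cell1 s' y)) (cell1 s y)
    & out s' = out s].

Lemma setM_setM u v r : setM u (setM v r) = setM u r. Proof. by case: r. Qed.
Lemma setM_id r : setM (tM r) r = r. Proof. by case: r. Qed.
Lemma tM_setM v r : tM (setM v r) = v. Proof. by case: r. Qed.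
Lemma tZ_setM v r : tZ (setM v r) = tZ r. Proof. by case: r. Qed.
Lemma sy_setM v r : sy (setM v r) = sy r. Proof. by case: r. Qed.

Lemma frame_trans s1 s2 s3 : frame s1 s2 -> frame s2 s3 -> frame s1 s3.
Proof.
move=> [EA EB Eo] [EA' EB' Eo']; split=> [x lt_x|y lt_y|]; last by rewrite Eo'.
  by rewrite EA' ?EA.
by rewrite EB' // tM_setM EB // setM_setM.
Qed.

Lemma frame_refl s : frame s s.
Proof. by split=> // y _; rewrite setM_id. Qed.

Lemma frame_eq s s' : (forall i x, x < L -> arr s' i x = arr s i x) -> out s' = out s ->
  frame s s'.
Proof.
move=> E Eo; split=> // x lt_x; first exact: E.
by rewrite /cell1 E // setM_id.
Qed.

Lemma frame_sy s s' : frame s s' -> sy_ok s -> sy_ok s'.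
Proof.
move=> [EA EB _] ok x lt_x; rewrite EA // EB // sy_setM.
exact: ok.
Qed.

Lemma frame_tZ s s' y : frame s s' -> y < L -> tZ (cell1 s' y) = tZ (cell1 s y).
Proof. by move=> [_ EB _] lt_y; rewrite EB // tZ_setM. Qed.

Lemma exec_updf g h s :
  [/\ fl (exec L (updf g) h s) = g (fl s),
      forall i x, x < L -> arr (exec L (updf g) h s) i x = arr s i x
    & out (exec L (updf g) h s) = out s].
Proof.
split=> //= i x lt_x; rewrite /rd ffunE; case: eqP => // <-.
by rewrite lt_x.
Qed.

Definition cand s x y := [&& tZ (cell1 s y), ~~ tM (cell1 s y) & key y == key x].

Lemma exec_try h s :
  let x := h t0 in let y := h t1 in let s' := exec L try_match h s in
  y < L -> wf_inst x -> (tZ (cell1 s y) -> wf_inst y) -> sy_ok s ->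
  [/\ frame s s', fk (fl s') = fk (fl s),
      ff (fl s') = ff (fl s) || cand s x y
    & forall z, z < L ->
        tM (cell1 s' z) = tM (cell1 s z) || [&& z == y, ~~ ff (fl s) & cand s x y]].
Proof.
move=> x y s' lt_y wx wy ok.
have Erd : rd (reads L h s) t1 = cell1 s y by rewrite /rd ffunE lt_y.
rewrite /s' /try_match; rewrite [exec _ (If _ _ _) _ _]/=; rewrite Erd /cand.
case: (boolP (ff _)) => [ffs|nff] /=.
  by split=> //; [exact: frame_refl | move=> z _; rewrite andbF orbF].
case Z : (tZ _) => /=; last first.
  by split=> //; [exact: frame_refl | exact/negbTE |
    move=> z _; rewrite andbF orbF].
case M : (tM _) => /=.
  by split=> //; [exact: frame_refl | exact/negbTE |
    move=> z _; rewrite andbF orbF].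
have [[r Ef] EA EB Eo] := exec_eq (h := h) wx (wy Z) ok.
set s1 := exec L eq_prog h s in Ef EA EB Eo *.
rewrite -/x -/y eq_sym in Ef.
have Efe : fe (fl s1) = (key y == key x) by rewrite Ef; case: (fl s).
have Erd1 : rd (reads L h s1) t1 = cell1 s y by rewrite /rd ffunE lt_y; exact: EB.
have EB' z : z < L ->
    (if z == y then setM (fe (fl s1)) (rd (reads L h s1) t1) else arr s1 t1 z) =
    setM (tM (cell1 s z) || (z == y) && (key y == key x)) (cell1 s z).
  move=> lt_z; rewrite Erd1 Efe; case: eqP => [->|_] /=; first by rewrite M.
  by rewrite orbF setM_id -EB.
split.
- split=> // [z lt_z|z lt_z]; rewrite /cell0 /cell1 /=.
    rewrite -/(cell0 s1 _) EA // /rd ffunE; case: eqP => // ->.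
    by rewrite -[h t0 < L]/(x < L) (leq_trans _ (wfk_lt wx)) /= -/(cell0 s1 _) ?EA ?(leq_trans _ (wfk_lt wx)) //; lia.
  by rewrite EB' // tM_setM.
- by rewrite /= Ef; case: (fl s).
- by rewrite /= Efe Ef; case: (fl s).
by move=> z lt_z; rewrite /cell1 /= EB' // tM_setM.
Qed.

Local Arguments exec : simpl never.

Lemma exec_match_one h s :
  let x := h t0 in let s' := exec L match_one h s in
  h t1 = 0 -> wf_inst x -> (forall y, y < L -> tZ (cell1 s y) -> wf_inst y) -> sy_ok s ->
  frame s s' /\
  ((fk (fl s') = fk (fl s) /\ exists y0,
     [/\ y0 < L, cand s x y0 & forall z, z < L -> tM (cell1 s' z) = tM (cell1 s z) || (z == y0)])
   \/ fk (fl s') = false /\ forall y, y < L -> ~~ cand s x y).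
Proof.
move=> x s' h1 wx wZ ok; rewrite /s' /match_one.
pose s1 := exec L (updf (setFound false)) h s.
have [Ef1 E1 Eo1] := exec_updf (setFound false) h s; rewrite -/s1 in Ef1 E1 Eo1.
pose s2 := foldl (fun s j => exec L try_match (shift [:: t1] h j) s) s1 (iota 0 L).
have inv m : m <= L ->
  let s2 := foldl (fun s j => exec L try_match (shift [:: t1] h j) s) s1 (iota 0 m) in
  [/\ frame s s2, fk (fl s2) = fk (fl s) &
    (ff (fl s2) /\ exists y0,
     [/\ y0 < L, cand s x y0 & forall z, z < L -> tM (cell1 s2 z) = tM (cell1 s z) || (z == y0)])
   \/ [/\ ff (fl s2) = false, forall z, z < L -> tM (cell1 s2 z) = tM (cell1 s z)
         & forall y, y < m -> ~~ cand s x y]].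
  elim: m => [|m IH] le_m.
    split; [exact: frame_eq | by rewrite /= /rd; case: (fl s) | right; split=> //].
      by rewrite /=; case: (fl s).
    by move=> z lt_z; congr (tM _); exact: E1.
  rewrite foldl_iotaS.
  have [Fr Ek Hff] := IH (ltnW le_m); set s3 := foldl _ s1 _ in Fr Ek Hff *; move=> s4'.
  have h0' : shift [:: t1] h m t0 = x by rewrite /shift addn0.
  have h1' : shift [:: t1] h m t1 = m by rewrite /shift h1.
  have [||||Fr' Ek' Eff EM] := @exec_try (shift [:: t1] h m) s3.
  - by rewrite h1'.
  - by rewrite h0'.
  - by rewrite h1' (frame_tZ Fr) //; exact: wZ.
  - exact: frame_sy Fr ok.
  rewrite h0' h1' in Eff EM; rewrite -/s4' in Fr' Ek' Eff EM; clearbody s4'.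
  split; [exact: frame_trans Fr Fr' | by rewrite Ek' |].
  case: Hff => [[fs3 [y0 [lt0 c0 EM3]]]|[fs3 EM3 nc]].
    left; rewrite Eff fs3; split=> //; exists y0; split=> // z lt_z.
    by rewrite EM // fs3 /= andbF orbF EM3.
  have Ec : cand s3 x m = cand s x m by rewrite /cand (frame_tZ Fr) // EM3.
  rewrite fs3 Ec /= in Eff EM; case: (boolP (cand s x m)) => c.
    left; rewrite Eff c; split=> //; exists m; split=> // z lt_z.
    by rewrite EM // c andbT EM3.
  right; rewrite Eff (negbTE c); split=> // [z lt_z|y].
    by rewrite EM // (negbTE c) andbF orbF EM3.
  by rewrite ltnS leq_eqVlt => /predU1P[-> //|]; exact: nc.
have [Fr Ek Hff] := inv L (leqnn L); rewrite -/s2 in Fr Ek Hff.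
have -> : exec L (Seq (updf (setFound false)) (Seq (Sweep t1 [::] try_match skip)
    (updf (fun a => setOk (fk a && ff a) a)))) h s =
    exec L (updf (fun a => setOk (fk a && ff a) a)) h s2.
  rewrite -[LHS]/(exec L (updf (fun a => setOk (fk a && ff a) a)) h
    (foldl (fun s _ => s) s2 (rev (iota 0 L)))).
  by rewrite foldl_const.
have [Ef5 E5 Eo5] := exec_updf (fun a => setOk (fk a && ff a) a) h s2.
set s5 := exec _ _ _ s2 in Ef5 E5 Eo5 *.
have Ek5 : fk (fl s5) = fk (fl s) && ff (fl s2) by rewrite Ef5 -Ek; case: (fl s2).
have EB5 z : z < L -> tM (cell1 s5 z) = tM (cell1 s2 z) by move=> lt_z; rewrite /cell1 E5.
split; first exact: frame_trans Fr (frame_eq E5 Eo5).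
case: Hff => [[fs2 [y0 [lt0 c0 EM]]]|[fs2 _ nc]]; [left|right].
  rewrite Ek5 fs2 andbT; split=> //; exists y0; split=> // z lt_z.
  by rewrite EB5 // EM.
by rewrite Ek5 fs2 andbF.
Qed.

Lemma cntS p m k : cnt p m.+1 k = cnt p m k + (p m && (key m == k)).
Proof. by rewrite /cnt -[in LHS](addn1 m) iotaD count_cat /= addn0. Qed.

Lemma eq_cnt (p q : pred nat) m k :
  (forall x, x < m -> p x = q x) -> cnt p m k = cnt q m k.
Proof.
by move=> E; apply: eq_in_count => x; rewrite mem_iota => /= /E ->.
Qed.

Lemma cnt_add1 p y m k :
  y < m -> ~~ p y -> cnt (fun x => p x || (x == y)) m k = cnt p m k + (key y == k).
Proof.
move=> lt_y ny; elim: m lt_y => // m IH; rewrite !cntS ltnS leq_eqVlt.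
case/predU1P => [<-|lt].
  rewrite (@eq_cnt _ p) => [|x lt_x]; first by rewrite eqxx orbT (negbTE ny) addn0.
  by rewrite (ltn_eqF lt_x) orbF.
by rewrite IH // (gtn_eqF lt) orbF addnAC.
Qed.

Lemma cnt_leq p m m' k : m <= m' -> cnt p m k <= cnt p m' k.
Proof. by move=> le_m; rewrite -(subnKC le_m) /cnt iotaD count_cat leq_addr. Qed.

Lemma count_sub_in (T : eqType) (a b : pred T) (l : seq T) :
  (forall x, x \in l -> a x -> b x) -> count a l <= count b l.
Proof.
elim: l => //= x l IH H; rewrite leq_add //.
  by case E : (a x) => //; rewrite H ?mem_head.
by apply: IH => y yl; apply: H; rewrite inE yl orbT.
Qed.

Lemma cnt_sub (p q : pred nat) m k : (forall x, x < m -> p x -> q x) -> cnt p m k <= cnt q m k.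
Proof.
by move=> H; apply: count_sub_in => x; rewrite mem_iota => lt_x /andP[/(H _ lt_x) -> ->].
Qed.

(** Success is described by equal counts for each name, failure by a name in short supply; together
    they decide multiset inclusion. *)
Lemma exec_match yp h s :
  let Y x := yp (cell0 s x) in let Z y := tZ (cell1 s y) in
  let s' := exec L (match_prog yp) h s in let M y := tM (cell1 s' y) in
  h t0 = 0 -> h t1 = 0 -> sy_ok s ->
  (forall x, x < L -> Y x -> wf_inst x) -> (forall y, y < L -> Z y -> wf_inst y) ->
  (forall y, y < L -> ~~ tM (cell1 s y)) ->
  frame s s' /\
  (if fk (fl s') then
     (forall y, y < L -> M y -> Z y) /\ forall k, cnt M L k = cnt Y L k
   else exists x, [/\ x < L, Y x & cnt Z L (key x) < cnt Y L (key x)]).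
Proof.
move=> Y Z s' M h0 h1 ok wY wZ M0; rewrite /M /s' /match_prog {M s'}.
pose s1 := exec L (updf (setOk true)) h s.
have [Ef1 E1 Eo1] := exec_updf (setOk true) h s; rewrite -/s1 in Ef1 E1 Eo1.
pose body := If (fun a (c : cells) => yp (rd c t0)) match_one skip : prg.
have inv m : m <= L ->
  let s' := foldl (fun s j => exec L body (shift [:: t0] h j) s) s1 (iota 0 m) in
  let M y := tM (cell1 s' y) in
  frame s s' /\
  (if fk (fl s') then
     (forall y, y < L -> M y -> Z y) /\ forall k, cnt M L k = cnt Y m k
   else exists x, [/\ x < L, Y x & cnt Z L (key x) < cnt Y m (key x)]).
  elim: m => [|m IH] le_m s' M.
    split; first exact: frame_eq.
    have -> : fk (fl s') by rewrite /s' /=; case: (fl s).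
    have EM y : y < L -> M y = false.
      by move=> lt_y; apply/negbTE; rewrite -[M y]/(tM (arr s1 t1 y)) E1 //; exact: M0.
    split=> [y lt_y|k]; first by rewrite EM.
    rewrite (eq_cnt _ (q := pred0)) // /cnt /=.
    by elim: (iota 0 L).
  rewrite /M /s' foldl_iotaS {M s'}.
  have [Fr HM] := IH (ltnW le_m); set s3 := foldl _ s1 _ in Fr HM *.
  have h0' : shift [:: t0] h m t0 = m by rewrite /shift h0.
  have h1' : shift [:: t0] h m t1 = 0 by rewrite /shift addn0.
  rewrite -[exec L body _ s3]/(if yp (rd (reads L (shift [:: t0] h m) s3) t0)
    then exec L match_one (shift [:: t0] h m) s3 else s3).
  have -> : rd (reads L (shift [:: t0] h m) s3) t0 = cell0 s m.
    by rewrite /rd ffunE h0' le_m /= -/(cell0 s3 m); case: Fr => ->.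
  case: (boolP (yp _)) => Ym; last first.
    split=> //; case: ifP HM => _.
      move=> [sMZ EM]; split=> // k.
      by rewrite EM cntS /Y (negbTE Ym) addn0.
    move=> [x [lt_x Yx lt]]; exists x; split=> //.
    by apply: leq_trans lt (cnt_leq _ _ _).
  have [||||Fr' HM'] := @exec_match_one (shift [:: t0] h m) s3.
  - exact: h1'.
  - by rewrite h0'; exact: wY.
  - by move=> y lt_y; rewrite (frame_tZ Fr) //; exact: wZ.
  - exact: frame_sy Fr ok.
  rewrite h0' in HM'; set s4 := exec _ _ _ s3 in Fr' HM' *.
  split; first exact: frame_trans Fr Fr'.
  case: HM' => [[-> [y0 [lt0 /and3P[Z0 nM0 /eqP k0] EM4]]]|[-> nc]].
    case: ifP HM => _; last first.
      move=> [x [lt_x Yx lt]]; exists x; split=> //.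
      by apply: leq_trans lt (cnt_leq _ _ _).
    move=> [sMZ EM]; split=> [y lt_y|k].
      rewrite EM4 // => /orP[|/eqP ->]; first exact: sMZ.
      by rewrite (frame_tZ Fr) in Z0.
    rewrite (eq_cnt _ EM4) cnt_add1 // EM cntS k0.
    by rewrite /Y Ym.
  case: (ifP (fk (fl s3))) HM => [_ [sMZ EM]|_].
    (* No candidate is left for [m], so all available instances of its name are used, and these are
       as many as the earlier requests for that name. *)
    exists m; split=> //; rewrite cntS /Y Ym eqxx addn1 ltnS -EM.
    apply: count_sub_in => y; rewrite mem_iota => lt_y /andP[Zy /eqP ky].
    rewrite ky eqxx andbT; have := nc y lt_y.
    by rewrite /cand (frame_tZ Fr) // [tZ _]Zy ky eqxx andbT negbK.
  move=> [x [lt_x Yx lt]]; exists x; split=> //.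
  by apply: leq_trans lt (cnt_leq _ _ _).
have -> : exec L (Seq (updf (setOk true)) (Sweep t0 [::] body skip)) h s =
    foldl (fun s j => exec L body (shift [:: t0] h j) s) s1 (iota 0 L).
  exact: foldl_const.
exact: inv.
Qed.

Lemma cntE p m k : cnt p m k = \sum_(x <- iota 0 m) (p x && (key x == k)).
Proof. by rewrite /cnt -sum1_count big_mkcond; apply: eq_bigr => x _; case: (_ && _). Qed.

Lemma ownS x : own x.+1 = own x + isPx x.+1.
Proof. by rewrite /own -[in LHS](addn1 x.+1) iotaD count_cat /= addn0. Qed.

Lemma own0 : own 0 = 0.
Proof. by rewrite /own /= /isPx /phs take0. Qed.

Lemma cnt_pred0 m k : cnt pred0 m k = 0.
Proof. by rewrite /cnt; elim: (iota 0 m). Qed.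

Lemma phs0 : phs 0 = P0.
Proof. by rewrite /phs take0. Qed.

Lemma phsS m : m < L -> phs m.+1 = delta (phs m) (syx m).
Proof. by move=> lt_m; rewrite /phs (take_nth Close) // foldl_rcons. Qed.

Lemma isPxE m : isPx m = isP (phs m) (syx m).
Proof. by []. Qed.

Lemma ownE m : own m = count isPx (iota 0 m) + isPx m.
Proof. by rewrite /own -(addn1 m) iotaD count_cat /= addn0. Qed.

End Positions.

(** * Correctness of the search *)

Local Arguments exec : simpl never.

Section Search.

Local Open Scope mset_scope.

Variables (Res : choiceType) (name : Res -> seq bool) (n : nat).
Variables (gam eps : 'I_n -> {mset Res}) (w : seq symbol).

Local Notation L := (size w).
Local Notation syx := (syx w).
Local Notation phs := (phs w).
Local Notation isPx := (isPx w).
Local Notation isGx := (isGx w).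
Local Notation isEx := (isEx w).
Local Notation own := (own w).
Local Notation key := (key w).
Local Notation cnt := (cnt w).

(** All that the search needs to know about the input word; these facts are derived from the
    encoding of the game afterwards. *)
Hypothesis own_le : forall x, x < L -> own x <= n.
Hypothesis inst_wf : forall x, x < L -> isGx x || isEx x ->
  [/\ wf_inst w x, 0 < own x & exists a, key x = name a].
Hypothesis gam_cnt : forall (i : 'I_n) a,
  gam i a = cnt (fun x => isGx x && (own x == i.+1)) L (name a).
Hypothesis eps_cnt : forall (i : 'I_n) a,
  eps i a = cnt (fun x => isEx x && (own x == i.+1)) L (name a).
Hypothesis ltnL : n < L.

Implicit Types (s : state) (h : tape_ix -> nat) (T U : {set 'I_n}) (P : pred nat).

Definition inS T (b : nat) : bool := [exists i in T, i.+1 == b].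

Lemma inS0 b : inS set0 b = false.
Proof. by apply/existsP => -[i]; rewrite inE. Qed.

Lemma inSU T U b : inS (T :|: U) b = inS T b || inS U b.
Proof.
apply/existsP/orP => [[i]|[]/existsP[i /andP[iT ib]]]; last 2 first.
- by exists i; rewrite inE iT.
- by exists i; rewrite inE iT orbT.
by rewrite inE andb_orl => /orP[]; [left | right]; apply/existsP; exists i.
Qed.

Lemma inSD T U b : inS (T :\: U) b = inS T b && ~~ inS U b.
Proof.
apply/existsP/andP => [[i]|[/existsP[i /andP[iT /eqP ib]]]].
  rewrite inE => /andP[/andP[iU iT] ib]; split; first by apply/existsP; exists i; rewrite iT.
  apply: contra iU => /existsP[j /andP[jU /eqP jb]].
  suff -> : i = j by [].
  by apply: val_inj; move/eqP: ib; rewrite -jb => -[].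
move=> nU; exists i; rewrite inE iT -ib eqxx !andbT.
by apply: contra nU => iU; apply/existsP; exists i; rewrite iU -ib eqxx.
Qed.

Lemma inS_blk b c : 0 < c <= n -> inS (blk n b) c = (c == b).
Proof.
move=> /andP[c0 le_c]; apply/existsP/eqP => [[i]|<-].
  by rewrite inE => /andP[/eqP <- /eqP].
have lt_c : c.-1 < n by lia.
by exists (Ordinal lt_c); rewrite inE /= prednK // eqxx.
Qed.

Lemma cnt_inS (lab : pred nat) T m k :
  cnt (fun x => lab x && inS T (own x)) m k =
  \sum_(i in T) cnt (fun x => lab x && (own x == (i : 'I_n).+1)) m k.
Proof.
under eq_bigr => i _ do rewrite cntE.
rewrite exchange_big cntE; apply: eq_bigr => x _ /=.
case: (lab x) => /=; last by rewrite big1.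
case: (key x == k); last by rewrite andbF big1 // => i _; rewrite andbF.
rewrite andbT; under eq_bigr => i _ do rewrite andbT.
case: (boolP (inS T (own x))) => [/existsP[i /andP[iT /eqP Ei]]|nS].
  rewrite (bigD1 i) //= Ei eqxx big1 // => j /andP[_ ne].
  rewrite -Ei; case: eqP => // -[/val_inj E]; by rewrite E eqxx in ne.
rewrite big1 // => i iT; case: eqP => // Ei; case/negP: nS.
by apply/existsP; exists i; rewrite iT Ei eqxx.
Qed.

Lemma sumg_cnt T a :
  sumg gam T a = cnt (fun x => isGx x && inS T (own x)) L (name a).
Proof. by rewrite big_msetDE cnt_inS; apply: eq_bigr => i _; exact: gam_cnt. Qed.

Lemma sume_cnt b a :
  sume eps b a = cnt (fun x => isEx x && inS (blk n b) (own x)) L (name a).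
Proof. by rewrite big_msetDE cnt_inS; apply: eq_bigr => i _; exact: eps_cnt. Qed.

(** The marks [tT] and [tU] are unspecified before the first player: when the candidate is block 0,
    the update marks the header in [tU], although no player is added. *)
Definition track_ok T U b c P s x : Prop :=
  [/\ sy (cell0 s x) = syx x, ph (cell0 s x) = phs x, hd (cell0 s x) = (own x == 0),
      sy (cell1 s x) = syx x
    & [/\ 0 < own x -> tT (cell0 s x) = inS T (own x),
          0 < own x -> tU (cell0 s x) = inS U (own x),
          tB (cell0 s x) = (own x == b), tC (cell0 s x) = (own x == c)
        & tP (cell0 s x) = P x]].

Definition tracks_rep T U b c P s : Prop :=
  out s = [::] /\ forall x, x < L -> track_ok T U b c P s x.

Lemma tracks_rep_sy T U b c P s : tracks_rep T U b c P s -> sy_ok w s.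
Proof. by move=> [_ H] x /H[]. Qed.

Lemma tracks_rep_frame T U b c P s s' : tracks_rep T U b c P s -> frame w s s' -> tracks_rep T U b c P s'.
Proof.
move=> [Eo H] [EA EB Eo']; split; first by rewrite Eo'.
by move=> x lt_x; rewrite /track_ok EA // EB // sy_setM; exact: H.
Qed.

Lemma sflag_const (g : rcell -> rcell -> rcell * rcell) a X Y m :
  scan_flags (fun a x y => (a, (g x y).1, (g x y).2)) a X Y m = a.
Proof. by elim: m => //= m ->. Qed.

Lemma exec_map0 g h s : h t0 = 0 -> h t1 = 0 ->
  let s' := exec L (map0 g) h s in
  [/\ fl s' = fl s, forall x, x < L -> cell0 s' x = g (cell0 s x) (cell1 s x),
      forall x, x < L -> cell1 s' x = cell1 s x & out s' = out s].
Proof.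
move=> h0 h1 s'; have [Ef EA EB Eo] := exec_scan L (fun a x y => (a, g x y, y)) s h0 h1.
have E m := sflag_const (fun x y => (g x y, y)) (fl s) (cell0 s) (cell1 s) m.
by split=> //; rewrite Ef E.
Qed.

Lemma exec_map1 g h s : h t0 = 0 -> h t1 = 0 ->
  let s' := exec L (map1 g) h s in
  [/\ fl s' = fl s, forall x, x < L -> cell0 s' x = cell0 s x,
      forall x, x < L -> cell1 s' x = g (cell0 s x) (cell1 s x) & out s' = out s].
Proof.
move=> h0 h1 s'; have [Ef EA EB Eo] := exec_scan L (fun a x y => (a, x, g x y)) s h0 h1.
have E m := sflag_const (fun x y => (x, g x y)) (fl s) (cell0 s) (cell1 s) m.
by split=> //; rewrite Ef E.
Qed.

Lemma exec_prep z h s T U b c P :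
  h t0 = 0 -> h t1 = 0 -> tracks_rep T U b c P s ->
  let s' := exec L (prep z) h s in
  [/\ tracks_rep T U b c P s', forall x, x < L -> cell0 s' x = cell0 s x,
      forall x, x < L -> tZ (cell1 s' x) = z (cell0 s x)
    & forall x, x < L -> tM (cell1 s' x) = false].
Proof.
move=> h0 h1 [Eo H] s'.
have [_ EA EB Eo'] := exec_map1 (fun x y => setZ (z x) (setM false y)) s h0 h1.
have EB' x : x < L -> [/\ tZ (cell1 s' x) = z (cell0 s x), tM (cell1 s' x) = false & sy (cell1 s' x) = sy (cell1 s x)].
  by move=> lt_x; rewrite /s' EB //; case: (cell1 s x).
split=> // [|x /EB'[]|x /EB'[]] //; split; first by rewrite Eo'.
by move=> x lt_x; rewrite /track_ok EA //; have [_ _ ->] := EB' _ lt_x; exact: H.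
Qed.

(** The name in short supply after a failure is that of an instance, hence the name of a resource,
    which refutes the inclusion. *)
Lemma exec_match_sub yp h s (X Z : {mset Res}) :
  let s' := exec L (match_prog yp) h s in
  h t0 = 0 -> h t1 = 0 -> sy_ok w s ->
  (forall x, x < L -> yp (cell0 s x) -> isGx x) ->
  (forall y, y < L -> tZ (cell1 s y) -> isGx y || isEx y) ->
  (forall y, y < L -> tM (cell1 s y) = false) ->
  (forall a, cnt (fun x => yp (cell0 s x)) L (name a) = X a) ->
  (forall a, cnt (fun x => tZ (cell1 s x)) L (name a) = Z a) ->
  [/\ frame w s s', fk (fl s') = (X `<=` Z)
    & X `<=` Z -> (forall y, y < L -> tM (cell1 s' y) -> tZ (cell1 s y)) /\
        forall a, cnt (fun y => tM (cell1 s' y)) L (name a) = X a].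
Proof.
move=> s' h0 h1 ok HY HZ HM EX EZ.
have [|||Fr HM'] := @exec_match w yp h s h0 h1 ok.
- by move=> x lt_x /(HY x lt_x) Gx; have [|//] := inst_wf lt_x; rewrite Gx.
- by move=> x lt_x /(HZ x lt_x)/(inst_wf lt_x)[].
- by move=> y /HM ->.
rewrite -/s' in Fr HM'; case: ifP HM' => [_ [sMZ EM]|_ [x [lt_x Yx lt]]].
  have sXZ : X `<=` Z.
    by apply/msubsetP => a; rewrite -EX -EZ -EM; exact: cnt_sub.
  by split=> // _; split=> // a; rewrite EM.
have nXZ : (X `<=` Z) = false.
  apply/negP => /msubsetP H; have [|_ _ [a Ea]] := inst_wf lt_x; first by rewrite (HY x).
  by rewrite Ea EX EZ ltnNge H in lt.
by rewrite nXZ.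
Qed.

Lemma exec_adv get set b h s :
  let s' := exec L (adv get set) h s in
  h t0 = 0 -> h t1 = 0 ->
  (forall x, x < L -> [/\ sy (cell0 s x) = syx x, ph (cell0 s x) = phs x & get (cell0 s x) = (own x == b)]) ->
  [/\ forall x, x < L -> cell0 s' x = set (own x == b.+1) (cell0 s x),
      forall x, x < L -> cell1 s' x = cell1 s x & out s' = out s].
Proof.
move=> s' h0 h1 H.
pose s1 := exec L (updf (set12 false false)) h s.
have [Ef1 E1 Eo1] := exec_updf w (set12 false false) h s; rewrite -/s1 in Ef1 E1 Eo1.
pose f (a : flags) x y :=
  let i := if isP (ph x) (sy x) then f1 a else f2 a in (set12 (get x) i a, set i x, y : rcell).
have [Ef EA EB Eo] := exec_scan L f s1 h0 h1.
set a := scan_flags f _ _ _ in Ef EA EB.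
have EA1 x : x < L -> cell0 s1 x = cell0 s x by exact: E1.
have key_step x : x < L -> f1 (a x) = (0 < x) && (own x.-1 == b) ->
    f2 (a x) = (0 < x) && (own x.-1 == b.+1) ->
    (if isPx x then f1 (a x) else f2 (a x)) = (own x == b.+1).
  case: x => [_|x lt_x] -> ->; first by rewrite own0 if_same.
  by rewrite ownS; case: (isPx _); rewrite ?addn0 ?addn1.
(* Both registers describe cell [m.-1]; they are false at the start, and the header is in block 0,
   never in [b.+1]. *)
have inv m : m <= L -> f1 (a m) = (0 < m) && (own m.-1 == b) /\
    f2 (a m) = (0 < m) && (own m.-1 == b.+1).
  elim: m => [_|m IH lt_m]; first by rewrite -[a 0]/(fl s1) Ef1; case: (fl s).
  have [IH1 IH2] := IH (ltnW lt_m); have K := key_step _ lt_m IH1 IH2.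
  rewrite -[a m.+1]/((f (a m) (cell0 s1 m) (cell1 s1 m)).1.1) /f EA1 //.
  have [-> -> ->] := H m lt_m; rewrite -/(isPx m) K /=.
  by case: (a m).
split=> [x lt_x|x lt_x|]; rewrite -?[s']/(exec L (scan f) h s1).
- rewrite EA // -[LHS]/(set (if isP (ph (cell0 s1 x)) (sy (cell0 s1 x))
    then f1 (a x) else f2 (a x)) (cell0 s1 x)) EA1 //; have [-> -> _] := H x lt_x.
  by have [I1 I2] := inv x (ltnW lt_x); rewrite -/(isPx x) key_step.
- by rewrite EB //; exact: E1.
by rewrite Eo.
Qed.

Lemma tracks_rep_lab T U b c P s x : tracks_rep T U b c P s -> x < L ->
  cell_isG (cell0 s x) = isGx x /\ cell_isE (cell0 s x) = isEx x.
Proof. by move=> [_ H] /H[Es Ep _ _ _]; rewrite /cell_isG /cell_isE Es Ep. Qed.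

Lemma inst_own x : x < L -> isGx x || isEx x -> 0 < own x <= n.
Proof. by move=> lt_x /(inst_wf lt_x)[_ -> _]; rewrite own_le. Qed.

Lemma tracks_rep_U T U U' b c P s s' v :
  tracks_rep T U b c P s -> out s' = out s -> (forall x, x < L -> cell1 s' x = cell1 s x) ->
  (forall x, x < L -> cell0 s' x = setU (v x) (cell0 s x)) ->
  (forall x, x < L -> 0 < own x -> v x = inS U' (own x)) ->
  tracks_rep T U' b c P s'.
Proof.
move=> [Eo H] Eo' EB EA Ev; split=> [|x lt_x]; first by rewrite Eo'.
have := Ev x lt_x; have := H x lt_x; rewrite /track_ok EA // EB //.
by case: (cell0 s x) => ? ? ? ? ? ? ? ? ? ? ? /= [? ? ? ? [? ? ? ? ?]] ?; split.
Qed.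

Lemma tracks_rep_C T U b c c' P s s' v :
  tracks_rep T U b c P s -> out s' = out s -> (forall x, x < L -> cell1 s' x = cell1 s x) ->
  (forall x, x < L -> cell0 s' x = setC (v x) (cell0 s x)) ->
  (forall x, x < L -> v x = (own x == c')) ->
  tracks_rep T U b c' P s'.
Proof.
move=> [Eo H] Eo' EB EA Ev; split=> [|x lt_x]; first by rewrite Eo'.
have := Ev x lt_x; have := H x lt_x; rewrite /track_ok EA // EB //.
by case: (cell0 s x) => ? ? ? ? ? ? ? ? ? ? ? /= [? ? ? ? [? ? ? ? ?]] ?; split.
Qed.

Lemma tracks_rep_B T U b b' c P s s' v :
  tracks_rep T U b c P s -> out s' = out s -> (forall x, x < L -> cell1 s' x = cell1 s x) ->
  (forall x, x < L -> cell0 s' x = setB (v x) (cell0 s x)) ->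
  (forall x, x < L -> v x = (own x == b')) ->
  tracks_rep T U b' c P s'.
Proof.
move=> [Eo H] Eo' EB EA Ev; split=> [|x lt_x]; first by rewrite Eo'.
have := Ev x lt_x; have := H x lt_x; rewrite /track_ok EA // EB //.
by case: (cell0 s x) => ? ? ? ? ? ? ? ? ? ? ? /= [? ? ? ? [? ? ? ? ?]] ?; split.
Qed.

Lemma tracks_rep_hd T U b c P s x : tracks_rep T U b c P s -> x < L -> hd (cell0 s x) = (own x == 0).
Proof. by move=> [_ H] /H[]. Qed.

Lemma tracks_rep_tracks T U b c P s x : tracks_rep T U b c P s -> x < L -> 0 < own x ->
  [/\ tT (cell0 s x) = inS T (own x), tU (cell0 s x) = inS U (own x),
      tB (cell0 s x) = (own x == b), tC (cell0 s x) = (own x == c) & tP (cell0 s x) = P x].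
Proof. by move=> [_ H] /H[_ _ _ _ [ET EU EB EC EP]] o0; split; auto. Qed.

Lemma closure_step h s T U b c P :
  h t0 = 0 -> h t1 = 0 -> tracks_rep T U b c P s ->
  tracks_rep T (cstep gam U c) b c.+1 P (exec L closure_body h s).
Proof.
move=> h0 h1 Hs.
pose s1 := exec L (prep (fun x => cell_isG x && tU x)) h s.
have [Hs1 EA1 EZ1 EM1] := exec_prep (fun x => cell_isG x && tU x) h0 h1 Hs.
rewrite -/s1 in Hs1 EA1 EZ1 EM1.
have own_G x : x < L -> isGx x -> 0 < own x <= n.
  by move=> lt_x Gx; apply: inst_own; rewrite ?Gx.
have EZ x : x < L -> tZ (cell1 s1 x) = isGx x && inS U (own x).
  move=> lt_x; rewrite EZ1 // (tracks_rep_lab Hs lt_x).1.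
  case Gx : (isGx x) => //=; have /andP[o0 _] := own_G _ lt_x Gx.
  by have [_ -> _ _ _] := tracks_rep_tracks Hs lt_x o0.
have EY x : x < L -> cell_isG (cell0 s1 x) && tC (cell0 s1 x) = isGx x && inS (blk n c) (own x).
  move=> lt_x; rewrite (tracks_rep_lab Hs1 lt_x).1; case Gx : (isGx x) => //=.
  have o0 := own_G _ lt_x Gx; rewrite inS_blk //; case/andP: o0 => o0 _.
  by have [_ _ _ -> _] := tracks_rep_tracks Hs1 lt_x o0.
pose s2 := exec L (match_prog (fun x => cell_isG x && tC x)) h s1.
have [|||||Fr Ek _] := @exec_match_sub (fun x => cell_isG x && tC x) h s1
  (sumg gam (blk n c)) (sumg gam U) h0 h1 (tracks_rep_sy Hs1).
- by move=> x lt_x; rewrite EY // => /andP[].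
- by move=> y lt_y; rewrite EZ // => /andP[->].
- exact: EM1.
- by move=> a; rewrite sumg_cnt; exact: eq_cnt.
- by move=> a; rewrite sumg_cnt; exact: eq_cnt.
rewrite -/s2 in Fr Ek; have Hs2 := tracks_rep_frame Hs1 Fr.
pose s3 := exec L (if_ok (map0 (fun x _ => setU (tU x || tC x) x))) h s2.
have Hs3 : tracks_rep T (cstep gam U c) b c P s3.
  have -> : s3 = if fk (fl s2) then exec L (map0 (fun x _ => setU (tU x || tC x) x)) h s2 else s2 by [].
  rewrite Ek /cstep; case: ifP => // _.
  have [_ EA EB Eo] := exec_map0 (fun x _ => setU (tU x || tC x) x) s2 h0 h1.
  apply: (tracks_rep_U Hs2 Eo EB EA) => x lt_x o0.
  have [_ -> _ -> _] := tracks_rep_tracks Hs2 lt_x o0.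
  by rewrite inSU inS_blk // o0 own_le.
have [|EA EB Eo] := @exec_adv tC setC c h s3 h0 h1.
  by move=> x lt_x; have [_ /(_ x lt_x)[-> -> _ _ [_ _ _ -> _]]] := Hs3.
exact: tracks_rep_C Hs3 Eo EB EA _.
Qed.

Lemma closure_correct h s T U b c P :
  h t0 = 0 -> h t1 = 0 -> tracks_rep T U b c P s ->
  exists c', tracks_rep T (clos gam L U) b c' P (exec L closure_prog h s).
Proof.
move=> h0 h1 Hs; rewrite /clos.
apply: (rep_ind (I := fun j s => exists c', tracks_rep T (iter j (cround gam L) U) b c' P s)) => //.
  by exists c.
move=> j {h0 h1 Hs}s {}h _ h0 h1 [{}c Hs]; rewrite iterS.
move: (iter j _ U) Hs => {}U Hs.
pose s1 := exec L (map0 (fun x _ => setC (hd x) x)) h s.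
have Hs1 : tracks_rep T U b 0 P s1.
  have [_ EA EB Eo] := exec_map0 (fun x _ => setC (hd x) x) s h0 h1.
  by apply: (tracks_rep_C Hs Eo EB EA) => x lt_x; rewrite (tracks_rep_hd Hs).
exists L; rewrite -[exec _ _ _ _]/(exec L (rep_loop t6 closure_body) h s1) /cround.
apply: (rep_ind (I := fun j s => tracks_rep T (foldl (cstep gam) U (iota 0 j)) b j P s)) => //.
move=> i s' h' _ h0' h1' Hs'; rewrite foldl_iotaS.
exact: closure_step.
Qed.

Lemma cnt_disjointU (p q : pred nat) m k :
  (forall x, x < m -> p x -> q x = false) ->
  cnt (fun x => p x || q x) m k = cnt p m k + cnt q m k.
Proof.
elim: m => // m IH H; rewrite !cntS IH => [|x lt_x]; last by apply: H; exact: ltnW.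
have := H m (ltnSn m); case: (p m) => [/(_ isT) ->|_] /=; first by rewrite addn0 addnAC.
by rewrite addn0 addnA.
Qed.

Lemma cnt_gt0 (p : pred nat) x m k : x < m -> p x -> key x = k -> 0 < cnt p m k.
Proof.
move=> lt_x px kx; rewrite -has_count; apply/hasP.
by exists x; rewrite ?mem_iota // px kx eqxx.
Qed.

Definition marks_rep (P : pred nat) (f : 'I_n -> {mset Res}) : Prop :=
  (forall x, x < L -> P x -> isEx x) /\
  forall i a, f i a = cnt (fun x => P x && (own x == i.+1)) L (name a).

Definition search_inv T b s : Prop := exists U c P f,
  [/\ tracks_rep T U b c P s, stage gam eps T f & marks_rep P f].

(** The matching may use the whole endowment of the candidate, marked or not, yet [M] and [P] are
    disjoint: a player with an old mark is in the closed set [T], so that [D] is empty and there is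
    no new mark. *)
Lemma commit_marks T b P (M : pred nat) f :
  stage gam eps T f -> marks_rep P f ->
  let D := sumg gam (clos gam L (T :|: blk n b) :\: T) in
  (forall x, x < L -> M x -> isEx x && inS (blk n b) (own x)) ->
  (forall a, cnt M L (name a) = D a) ->
  marks_rep (fun x => P x || M x)
    (fun i => f i `+` (if i \in blk n b then D else mset0)).
Proof.
move=> [T_cl _ f_out _ _] [sPE Ef] D HM ED; split.
  by move=> x lt_x /orP[/(sPE x lt_x) // | /(HM x lt_x)/andP[]].
have own_M x : x < L -> M x -> exists2 i : 'I_n, i \in blk n b & own x = i.+1.
  by move=> lt_x /(HM x lt_x)/andP[_ /existsP[i /andP[ib /eqP]]]; exists i.
have dis x : x < L -> P x -> M x = false.
  move=> lt_x Px; apply/negP => Mx; have [i ib Ei] := own_M x lt_x Mx.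
  have [|_ _ [a Ea]] := inst_wf lt_x; first by rewrite (sPE x) ?orbT.
  have D0 : 0 < D a by rewrite -ED -Ea; exact: cnt_gt0 lt_x Mx _.
  have f0 : 0 < f i a by rewrite Ef -Ea; apply: (cnt_gt0 lt_x) => //; rewrite Px Ei eqxx.
  case: (boolP (i \in T)) => [iT|/f_out E]; last by rewrite E mset0E in f0.
  case: T_cl => [T0|T_cl]; first by rewrite T0 inE in iT.
  have sbT : blk n b \subset T.
    apply/subsetP => j; move: ib; rewrite !inE => /eqP <- /eqP[/val_inj ->] //.
  by move: D0; rewrite /D (setUidPl sbT) clos_id // setDv sumg0 mset0E.
move=> i a; rewrite msetE2 Ef.
have -> : (if i \in blk n b then D else mset0) a =
    cnt (fun x => M x && (own x == i.+1)) L (name a).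
  case: ifP => ib.
    rewrite -ED; apply: eq_cnt => x lt_x; case Mx : (M x) => //=.
    have [j jb ->] := own_M x lt_x Mx; move: ib jb; rewrite !inE => /eqP <- /eqP[->].
    by rewrite eqxx.
  rewrite mset0E (eq_cnt _ (q := pred0)) => [|x lt_x]; first by rewrite cnt_pred0.
  apply/negP => /andP[/(own_M x lt_x)[j jb ->] /eqP[/val_inj E]].
  by rewrite -E jb in ib.
rewrite -cnt_disjointU => [|x lt_x /andP[Px _]]; last by rewrite dis.
by apply: eq_cnt => x _; rewrite andb_orl.
Qed.

Lemma candidate_step h s T b :
  h t0 = 0 -> h t1 = 0 -> search_inv T b s ->
  search_inv (ostep gam eps L T b) b.+1 (exec L candidate_body h s).
Proof.
move=> h0 h1 [U [c [P [f [Hs f_inv f_rep]]]]].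
pose T' := clos gam L (T :|: blk n b); pose D := sumg gam (T' :\: T).
pose s1 := exec L (map0 (fun x _ => setU (tT x || tB x) x)) h s.
have Hs1 : tracks_rep T (T :|: blk n b) b c P s1.
  have [_ EA EB Eo] := exec_map0 (fun x _ => setU (tT x || tB x) x) s h0 h1.
  apply: (tracks_rep_U Hs Eo EB EA) => x lt_x o0.
  have [-> _ -> _ _] := tracks_rep_tracks Hs lt_x o0.
  by rewrite inSU inS_blk // o0 own_le.
pose s2 := exec L closure_prog h s1.
have [c' Hs2] := closure_correct h0 h1 Hs1; rewrite -/s2 -/T' in Hs2.
pose s3 := exec L (prep (fun x => cell_isE x && tB x)) h s2.
have [Hs3 EA3 EZ3 EM3] := exec_prep (fun x => cell_isE x && tB x) h0 h1 Hs2.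
rewrite -/s3 in Hs3 EA3 EZ3 EM3.
have EZ x : x < L -> tZ (cell1 s3 x) = isEx x && inS (blk n b) (own x).
  move=> lt_x; rewrite EZ3 // (tracks_rep_lab Hs2 lt_x).2.
  case Ex : (isEx x) => //=; have o0 : 0 < own x <= n by rewrite inst_own ?Ex ?orbT.
  rewrite inS_blk //; case/andP: o0 => o0 _.
  by have [_ _ -> _ _] := tracks_rep_tracks Hs2 lt_x o0.
pose yp x := [&& cell_isG x, tU x & ~~ tT x].
have EY x : x < L -> yp (cell0 s3 x) = isGx x && inS (T' :\: T) (own x).
  move=> lt_x; rewrite /yp (tracks_rep_lab Hs3 lt_x).1; case Gx : (isGx x) => //=.
  have /andP[o0 _] : 0 < own x <= n by rewrite inst_own ?Gx.
  by have [-> -> _ _ _] := tracks_rep_tracks Hs3 lt_x o0; rewrite inSD.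
pose s4 := exec L (match_prog yp) h s3.
have [|||||Fr Ek Hok] := @exec_match_sub yp h s3 D (sume eps b) h0 h1 (tracks_rep_sy Hs3).
- by move=> x lt_x; rewrite EY // => /andP[].
- by move=> y lt_y; rewrite EZ // => /andP[-> _]; rewrite orbT.
- exact: EM3.
- by move=> a; rewrite sumg_cnt; exact: eq_cnt.
- by move=> a; rewrite sume_cnt; exact: eq_cnt.
rewrite -/s4 in Fr Ek Hok; have Hs4 := tracks_rep_frame Hs3 Fr.
pose g x y := setP (tP x || tM y) (setT (tU x) x).
pose s5 := exec L (if_ok (map0 g)) h s4.
have Es5 : s5 = if fk (fl s4) then exec L (map0 g) h s4 else s4 by [].
have [U5 [P5 [f5 [Hs5 f5_inv f5_rep]]]] : exists U P f,
    [/\ tracks_rep (ostep gam eps L T b) U b c' P s5, stage gam eps (ostep gam eps L T b) f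
      & marks_rep P f].
  rewrite Es5 Ek /ostep /ocond -/T' -/D; case: ifP => [ok|_]; last by exists T', P, f.
  have [sMZ EM] := Hok ok.
  exists T', (fun x => P x || tM (cell1 s4 x)),
    (fun i => f i `+` (if i \in blk n b then D else mset0)); split.
  - have [_ EA EB Eo] := exec_map0 g s4 h0 h1.
    have [Eo4 H4] := Hs4; split=> [|x lt_x]; first by rewrite Eo.
    have := H4 x lt_x; rewrite /track_ok EA // EB // /g.
    by case: (cell0 s4 x) => ? ? ? ? ? ? ? ? ? ? ? /= [? ? ? ? [? ? ? ? ->]]; split.
  - by apply: (stage_step ltnL f_inv) => //; rewrite /ocond -/T' -/D.
  apply: commit_marks => // x lt_x /(sMZ x lt_x); by rewrite EZ.
have [|EA EB Eo] := @exec_adv tB setB b h s5 h0 h1.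
  by move=> x lt_x; have [_ /(_ x lt_x)[-> -> _ _ [_ _ -> _ _]]] := Hs5.
by exists U5, c', P5, f5; split=> //; exact: (tracks_rep_B Hs5 Eo EB EA).
Qed.

Lemma search_correct h s T :
  h t0 = 0 -> h t1 = 0 -> (exists b, search_inv T b s) ->
  exists b, search_inv (iter L (opass gam eps L) T) b (exec L search_prog h s).
Proof.
move=> h0 h1 Hs.
apply: (rep_ind (I := fun j s => exists b, search_inv (iter j (opass gam eps L) T) b s)) => //.
move=> j {h0 h1 Hs}s {}h _ h0 h1 [b [U [c [P [f [Hs f_inv f_rep]]]]]]; rewrite iterS.
move: (iter j _ T) Hs f_inv => {}T Hs f_inv.
pose s1 := exec L (map0 (fun x _ => setB (hd x) x)) h s.
have Hs1 : search_inv T 0 s1.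
  exists U, c, P, f; split=> //.
  have [_ EA EB Eo] := exec_map0 (fun x _ => setB (hd x) x) s h0 h1.
  by apply: (tracks_rep_B Hs Eo EB EA) => x lt_x; rewrite (tracks_rep_hd Hs).
exists L; rewrite -[exec _ _ _ _]/(exec L (rep_loop t4 candidate_body) h s1) /opass.
apply: (rep_ind (I := fun j s => search_inv (foldl (ostep gam eps L) T (iota 0 j)) j s)) => //.
move=> i s' h' _ h0' h1' Hs'; rewrite foldl_iotaS.
exact: candidate_step.
Qed.

(** The block number [n.+1] stands for marks that are nowhere set, since no position has it. *)
Lemma parse_correct h s :
  h t0 = 0 -> h t1 = 0 -> out s = [::] -> fl s = flags0 ->
  (forall i x, x < L -> arr s i x = ini (syx x)) ->
  search_inv set0 n.+1 (exec L parse h s).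
Proof.
move=> h0 h1 Eo Ef Earr.
pose f (a : flags) x (y : rcell) :=
  let q := fq a in let h := fh a && ~~ isP q (sy x) in
  (setQH (delta q (sy x)) h a,
   RCell (sy x) q h false false false false false false false false, y).
have [_ EA EB Eo'] := exec_scan L f s h0 h1.
rewrite -/parse in EA EB Eo'.
set a := scan_flags f _ _ _ in EA EB.
have inv m : m <= L -> fq (a m) = phs m /\ fh (a m) = (count isPx (iota 0 m) == 0).
  elim: m => [_|m IH lt_m]; first by rewrite -[a 0]/(fl s) Ef phs0.
  have [IH1 IH2] := IH (ltnW lt_m).
  rewrite -[a m.+1]/((f (a m) (cell0 s m) (cell1 s m)).1.1) /f /cell0 Earr // phsS //.
  rewrite -[count _ _]/(own m) ownE addn_eq0 eqb0 isPxE -IH1 -IH2.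
  by case: (a m).
exists set0, n.+1, pred0, (fun=> mset0); split.
- split=> [|x lt_x]; first by rewrite Eo' Eo.
  rewrite /track_ok EA // EB // /f /cell0 /cell1 !Earr //=.
  have [E1 E2] := inv x (ltnW lt_x); have le_o := own_le lt_x.
  split=> //; first by rewrite E1 E2 ownE addn_eq0 eqb0 isPxE.
  split=> //; rewrite ?inS0 //; by rewrite ltn_eqF.
- exact: stage0.
by split=> // i a'; rewrite mset0E cnt_pred0.
Qed.

End Search.

(** * Emission and the structure of the input *)

(* The second component tells whether the first symbol is emitted, [z] being
   its value at the end of the word. *)
Fixpoint emission (z : bool) (q : phase) (f : bool) (l : seq (symbol * bool)) :
    seq symbol * bool :=
  if l is (s, p) :: l' then
    let: (f', k0) := keep_step f q s p in
    let: (o, k1) := emission z (delta q s) f' l' in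
    let k := if (q, s) is (B0, Open) then k1 else k0 in
    (if k then s :: o else o, k)
  else ([::], z).

(* A resource instance: whether it is in an endowment, its player (counted from
   1), the word that starts at its opening bracket, and its mark. *)
Record item := Item {
  it_end : bool; it_own : nat; it_word : seq symbol; it_mark : bool }.

Definition it_key it := bits_of (behead (it_word it)).

Fixpoint items (q : phase) (o : nat) (l : seq (symbol * bool)) : seq item :=
  if l is (s, p) :: l' then
    let o' := o + isP q s in
    let r := items (delta q s) o' l' in
    if isG q s || isE q s then Item (isE q s) o' (unzip1 l) p :: r else r
  else [::].

Fixpoint nb_players (q : phase) (l : seq (symbol * bool)) : nat :=
  if l is (s, _) :: l' then isP q s + nb_players (delta q s) l' else 0.

Section Marked.

Variables (w : seq symbol) (P : pred nat).

Local Notation L := (size w).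

Definition marked m : seq (symbol * bool) :=
  zip (drop m w) (map P (iota m (L - m))).

Lemma markedS m : m < L -> marked m = (syx w m, P m) :: marked m.+1.
Proof.
move=> lt_m; have E : L - m = (L - m.+1).+1 by lia.
by rewrite /marked (drop_nth Close) // E.
Qed.

Lemma marked_size : marked L = [::].
Proof. by rewrite /marked subnn drop_size. Qed.

Lemma unzip1_marked m : unzip1 (marked m) = drop m w.
Proof. by rewrite unzip1_zip // size_drop size_map size_iota. Qed.

Definition pos_item x := Item (isEx w x) (own w x) (drop x w) (P x).

Lemma down_ind (Q : nat -> Prop) :
  Q L -> (forall m, m < L -> Q m.+1 -> Q m) -> forall m, m <= L -> Q m.
Proof.
move=> QL QS m le_m; rewrite -(subKn le_m); elim: (L - m) (leq_subr m L) => [|d IH] le_d.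
  by rewrite subn0.
apply: QS; first by lia.
have -> : (L - d.+1).+1 = L - d by lia.
by apply: IH; exact: ltnW.
Qed.

(** Passes from positions, used by the search, to a recursion over suffixes, used to analyse the
    encoding. *)
Lemma items_marked m : m <= L ->
  items (phs w m) (count (isPx w) (iota 0 m)) (marked m) =
  [seq pos_item x | x <- iota m (L - m) & isGx w x || isEx w x].
Proof.
move: m; apply: down_ind => [|m lt_m IH]; first by rewrite marked_size subnn.
have -> : iota m (L - m) = m :: iota m.+1 (L - m.+1).
  have E : L - m = (L - m.+1).+1 by lia.
  by rewrite E.
have Eo : count (isPx w) (iota 0 m) + isP (phs w m) (syx w m) = own w m by rewrite ownE.
rewrite markedS //= Eo.
rewrite -phsS // -[own w m]/(count (isPx w) (iota 0 m.+1)) IH.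
rewrite -/(isGx w m) -/(isEx w m); case: (_ || _) => //=; congr (_ :: _).
rewrite /pos_item; congr (Item _ _ _ _).
by rewrite [RHS](drop_nth Close) // -unzip1_marked.
Qed.

Lemma nP_marked m : m <= L ->
  count (isPx w) (iota 0 m) + nb_players (phs w m) (marked m) = count (isPx w) (iota 0 L).
Proof.
move: m; apply: down_ind => [|m lt_m <-]; first by rewrite marked_size addn0.
by rewrite markedS //= addnA -phsS // -isPxE -ownE.
Qed.

Fixpoint keep_flag (f : bool) m : bool :=
  if m is m'.+1 then (keep_step (keep_flag f m') (phs w m') (syx w m') (P m')).1 else f.

Variables (n : nat) (T U : {set 'I_n}) (b c : nat).

(** The values [z] and [f] are whatever the register happens to hold; on an encoding they do not
    influence the result. *)
Lemma exec_emit h s :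
  h t0 = 0 -> h t1 = 0 -> tracks_rep w T U b c P s ->
  exists z f, out (exec L emit_prog h s) = (emission z P0 f (marked 0)).1.
Proof.
move=> h0 h1 [Eo H].
pose g (a : flags) x (y : rcell) :=
  let: (f, k) := keep_step (f1 a) (ph x) (sy x) (tP x) in
  (set12 f false a, setK k x, y).
pose s1 := exec L (scan g) h s.
have [_ EA _ Eo1] := exec_scan L g s h0 h1; rewrite -/s1 in EA Eo1.
set a := scan_flags g _ _ _ in EA.
pose f := f1 (fl s).
have Ef m : m <= L -> f1 (a m) = keep_flag f m.
  elim: m => // m IH lt_m; rewrite -[a m.+1]/((g (a m) (cell0 s m) (cell1 s m)).1.1) /= /g.
  have [-> -> _ _ [_ _ _ _ ->]] := H m lt_m; rewrite IH; last exact: ltnW.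
  by case: (keep_step _ _ _ _) => ? ? /=; case: (a m).
have EA1 x : x < L -> [/\ sy (cell0 s1 x) = syx w x, ph (cell0 s1 x) = phs w x
    & tK (cell0 s1 x) = (keep_step (keep_flag f x) (phs w x) (syx w x) (P x)).2].
  move=> lt_x; rewrite EA // /g Ef; last exact: ltnW.
  have [Es Ep _ _ [_ _ _ _ EP]] := H x lt_x; rewrite Es Ep EP.
  case: (keep_step _ _ _ _) => ? ? /=; move: Es Ep.
  by case: (cell0 s x).
pose body : prg := Upd (fun a c =>
          let x := rd c t0 in
          let k := if (ph x, sy x) is (B0, Open) then f1 a else tK x in
          (set12 k false a, rd c, if k then Some (sy x) else None)).
exists (f1 (fl s1)), f.
have -> : exec L emit_prog h s =
    foldl (fun s j => exec L body (shift [:: t0] h j) s) s1 (rev (iota 0 L)).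
  rewrite -[LHS]/(foldl (fun s j => exec L body (shift [:: t0] h j) s)
    (foldl (fun s _ => s) s1 (iota 0 L)) (rev (iota 0 L))).
  by rewrite foldl_const.
have inv m : m <= L ->
  let s' := foldl (fun s j => exec L body (shift [:: t0] h j) s) s1 (rev (iota m (L - m))) in
  [/\ forall x, x < L -> cell0 s' x = cell0 s1 x,
      f1 (fl s') = (emission (f1 (fl s1)) (phs w m) (keep_flag f m) (marked m)).2
    & out s' = (emission (f1 (fl s1)) (phs w m) (keep_flag f m) (marked m)).1].
  move: m; apply: down_ind => [|m lt_m IH].
    by rewrite subnn marked_size /= Eo1.
  have -> : iota m (L - m) = m :: iota m.+1 (L - m.+1).
    have E : L - m = (L - m.+1).+1 by lia.
    by rewrite E.
  rewrite rev_cons foldl_rcons; move: IH; set s2 := foldl _ s1 _.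
  move=> [EA2 Ef2 Eo2] s3.
  have Erd : rd (reads L (shift [:: t0] h m) s2) t0 = cell0 s1 m.
    by rewrite /rd ffunE /shift h0 /= add0n lt_m /= -/(cell0 s2 m) EA2.
  pose k := if (ph (cell0 s1 m), sy (cell0 s1 m)) is (B0, Open) then f1 (fl s2) else tK (cell0 s1 m).
  have Es3 : s3 = Store (set12 k false (fl s2))
      (fun i x => if x == shift [:: t0] h m i then rd (reads L (shift [:: t0] h m) s2) i
                  else arr s2 i x)
      (if k then sy (cell0 s1 m) :: out s2 else out s2).
    by rewrite /s3 /body /exec Erd -/k; case: (k).
  have [E1 E2 E3] := EA1 m lt_m.
  have Ek : (emission (f1 (fl s1)) (phs w m) (keep_flag f m) (marked m)) =
      (if k then sy (cell0 s1 m) :: out s2 else out s2, k).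
    rewrite markedS // {1}/emission -/emission /k E1 E2 E3 Ef2 Eo2 phsS //.
    rewrite -[keep_flag f m.+1]/((keep_step (keep_flag f m) (phs w m) (syx w m) (P m)).1).
    by case: (keep_step _ _ _ _) => f' k0 /=; case: (emission _ _ _ _).
  rewrite Ek Es3 /=; split=> //; last by case: (fl s2).
  move=> x lt_x; rewrite /cell0 /=; case: eqP => [->|_]; last by rewrite -/(cell0 s2 x) EA2.
  by rewrite Erd /shift h0 add0n.
by have [_ _] := inv 0 (leq0n L); rewrite subn0 phs0 => ->.
Qed.

End Marked.

Local Arguments enc_res : simpl never.
Local Arguments enc_bundle : simpl never.
Local Arguments enc_bag : simpl never.

Lemma flatten_map_cons (S T : Type) (g : S -> seq T) a s :
  flatten (map g (a :: s)) = g a ++ flatten (map g s).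
Proof. by []. Qed.

Lemma flatten2 (T : Type) (u v : seq T) : flatten [:: u; v] = u ++ v.
Proof. by rewrite /= cats0. Qed.

(** * Reading an encoded game piece by piece *)

Section Encodings.

Variables (Res : finType) (name : Res -> seq bool) (z : bool).

(* Reading [l] down to its suffix [l'] emits [O], meets the instances [I], and
   takes the automaton, the player count and the selection flag from
   [(q, o, f)] to [(q', o', f')]. *)
Definition chunk q o f l O I q' o' f' l' : Prop :=
  [/\ (emission z q f l).1 = O ++ (emission z q' f' l').1,
      items q o l = I ++ items q' o' l'
    & o + nb_players q l = o' + nb_players q' l'].

Lemma chunk_trans q1 o1 f1 l1 O I q2 o2 f2 l2 O' I' q3 o3 f3 l3 :
  chunk q1 o1 f1 l1 O I q2 o2 f2 l2 -> chunk q2 o2 f2 l2 O' I' q3 o3 f3 l3 ->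
  chunk q1 o1 f1 l1 (O ++ O') (I ++ I') q3 o3 f3 l3.
Proof. by move=> [E1 E2 E3] [F1 F2 F3]; split; rewrite ?E1 ?E2 ?E3 ?F1 ?F2 ?F3 ?catA. Qed.

(** Excluded are the two kinds of symbols with a further effect: the start of an instance and the
    opening bracket of a bundle, whose emission depends on the next symbol. *)
Lemma chunk_step q o f s p l :
  ~~ (isG q s || isE q s) -> ~~ (if (q, s) is (B0, Open) then true else false) ->
  chunk q o f ((s, p) :: l) (if (keep_step f q s p).2 then [:: s] else [::]) [::]
    (delta q s) (o + isP q s) (keep_step f q s p).1 l.
Proof.
move=> /negbTE nI nB; split; last by rewrite /= addnA.
  rewrite [emission _ _ _ (_ :: _)]/=; case: (keep_step _ _ _ _) => f' k /=.
  case: (emission _ _ _ _) => u k1 /=.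
  by case: q nB {nI}; case: s => [b||] //= _; case: k.
by rewrite /= nI.
Qed.

Lemma chunk_G o f p l :
  chunk G0 o f ((Open, p) :: l) [::] [:: Item false o (Open :: unzip1 l) p]
    G1 o f l.
Proof. by split; rewrite //= ?addn0 //; case: (emission _ _ _ _). Qed.

Definition bit_phase q := if q is T1 then true else if q is G1 then true else false.

Lemma chunk_bits q o f l bs r :
  bit_phase q -> unzip1 l = map Bit bs ++ r ->
  exists2 l', unzip1 l' = r & chunk q o f l [::] [::] q o f l'.
Proof.
move=> Hq; elim: bs l => [|b bs IH] l /= E; first by exists l.
case: l E => [|[s p] l] //= [-> /IH[l' El' C]]; exists l' => //.
have := @chunk_step q o f (Bit b) p l.
by case: q Hq C {IH} => // _ C /(_ isT isT); rewrite /= addn0 => /chunk_trans; apply.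
Qed.

Lemma chunk_bitsB o f l bs r :
  unzip1 l = map Bit bs ++ r ->
  exists2 l', unzip1 l' = r &
    chunk B2 o f l (if f then map Bit bs else [::]) [::] B2 o f l'.
Proof.
elim: bs l => [|b bs IH] l /= E; first by exists l => //; rewrite if_same.
case: l E => [|[s p] l] //= [-> /IH[l' El' C]]; exists l' => //.
have /= := @chunk_step B2 o f (Bit b) p l isT isT; rewrite addn0.
by move=> /chunk_trans/(_ C); case: (f).
Qed.

Lemma enc_resE a r :
  enc_res name a ++ r = Open :: map Bit (name a) ++ Close :: r.
Proof. by rewrite /enc_res /enc_list /= -catA; congr (_ :: _ ++ _); elim: (name a) => //= b l ->. Qed.

Lemma chunk_types o f l s r :
  unzip1 l = flatten (map (enc_res name) s) ++ r ->
  exists l' f', unzip1 l' = r /\ chunk T0 o f l [::] [::] T0 o f' l'.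
Proof.
elim: s l f => [|a s IH] l f; first by exists l, f.
rewrite (flatten_map_cons (enc_res name)) -catA enc_resE.
case: l => [|[s1 p1] l] //= [-> E1].
have [l1 E2 C2] := @chunk_bits T1 o f _ _ _ isT E1.
case: l1 E2 C2 => [|[s2 p2] l1] //= [-> E2] C2.
have [l' [f' [El' C3]]] := IH l1 f E2.
exists l', f'; split=> //.
have /= C1 := @chunk_step T0 o f Open p1 l isT isT.
have /= C4 := @chunk_step T1 o f Close p2 l1 isT isT.
rewrite addn0 in C1; rewrite addn0 in C4.
exact: chunk_trans C1 (chunk_trans C2 (chunk_trans C4 C3)).
Qed.

Definition wf_suffix (u : seq symbol) : Prop :=
  exists r a, u = Open :: map Bit (name a) ++ Close :: r.

Definition good (I : seq item) : Prop :=
  forall t, t \in [seq (it_own it, it_word it) | it <- I] -> 0 < t.1 /\ wf_suffix t.2.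

Lemma good_cat I J : good I -> good J -> good (I ++ J).
Proof. by move=> HI HJ t; rewrite map_cat mem_cat => /orP[/HI|/HJ]. Qed.

Definition inst (it : item) := (it_end it, it_own it, it_key it).

Lemma bits_of_map bs r : bits_of (map Bit bs ++ Close :: r) = bs.
Proof. by elim: bs => //= b bs ->. Qed.

Lemma chunk_goal o f l s r :
  0 < o -> unzip1 l = flatten (map (enc_res name) s) ++ r ->
  exists l' f' I, [/\ unzip1 l' = r, chunk G0 o f l [::] I G0 o f' l',
    map inst I = [seq (false, o, name a) | a <- s] & good I].
Proof.
move=> o0; elim: s l f => [|a s IH] l f; first by exists l, f, [::].
rewrite (flatten_map_cons (enc_res name)) -catA enc_resE.
case: l => [|[s1 p1] l] //= [-> E1].
have [l1 E2 C2] := @chunk_bits G1 o f _ _ _ isT E1.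
case: l1 E2 C2 => [|[s2 p2] l1] //= [-> E2] C2.
have [l' [f' [I [El' C3 EI HI]]]] := IH l1 f E2.
pose it := Item false o (Open :: unzip1 l) p1.
exists l', f', (it :: I); split=> //.
- have /= C4 := @chunk_step G1 o f Close p2 l1 isT isT; rewrite addn0 in C4.
  exact: chunk_trans (chunk_G o f p1 l) (chunk_trans C2 (chunk_trans C4 C3)).
- by rewrite /= EI /inst /= /it_key /= E1 bits_of_map.
apply: (@good_cat [:: it]) => // t; rewrite inE => /eqP -> /=; split=> //.
by exists (flatten [seq enc_res name i | i <- s] ++ r), a; rewrite E1.
Qed.

Lemma chunk_bundle o f l a r :
  0 < o -> unzip1 l = enc_bundle name [:: a] ++ r ->
  exists l' f' it, [/\ unzip1 l' = r,
    chunk B0 o f l (if it_mark it then enc_bundle name [:: a] else [::]) [:: it] B0 o f' l',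
    inst it = (true, o, name a) & good [:: it]].
Proof.
move=> o0; have Eenc r' : enc_bundle name [:: a] ++ r' =
    [:: Open, Open & map Bit (name a) ++ [:: Close, Close & r']].
  have -> : enc_bundle name [:: a] = Open :: enc_res name a ++ [:: Close].
    by rewrite /enc_bundle {1}/enc_list /= cats0.
  by rewrite cat_cons -catA enc_resE.
rewrite Eenc; case: l => [|[s1 p1] [|[s2 p2] l]] //= [-> -> E1].
have [l1 E2 C2] := @chunk_bitsB o p2 _ _ _ E1.
case: l1 E2 C2 => [|[s3 p3] [|[s4 p4] l1]] //= [-> -> E2] C2.
pose it := Item true o (Open :: unzip1 l) p2.
exists l1, p2, it; split=> //.
- have /= C3 := @chunk_step B2 o p2 Close p3 ((Close, p4) :: l1) isT isT.
  have /= C4 := @chunk_step B1 o p2 Close p4 l1 isT isT.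
  rewrite addn0 in C3; rewrite addn0 in C4.
  (* The first two brackets are unfolded by hand: the outer one is emitted iff the inner one is,
     that is, iff [p2] holds. *)
  have [F1 F2 F3] := chunk_trans C2 (chunk_trans C3 C4).
  split; rewrite [LHS]/= ?addn0 ?F2 ?F3 //.
  move: F1; case: (emission _ _ _ l) => u k /= ->.
  have := Eenc [::]; rewrite cats0 => ->.
  by rewrite /it /=; case: (p2) => //=; rewrite -!catA.
- by rewrite /inst /= /it_key /= E1 bits_of_map.
move=> t; rewrite inE => /eqP -> /=; split=> //.
by exists (Close :: r), a; rewrite E1.
Qed.

Lemma chunk_bundles o f l s r :
  0 < o -> unzip1 l = flatten [seq enc_bundle name [:: a] | a <- s] ++ r ->
  exists l' f' I, [/\ unzip1 l' = r,
    chunk B0 o f l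
      (flatten [seq enc_bundle name [:: a] | a <- mask (map it_mark I) s]) I B0 o f' l',
    map inst I = [seq (true, o, name a) | a <- s] & good I].
Proof.
move=> o0; elim: s l f => [|a s IH] l f; first by exists l, f, [::].
rewrite (flatten_map_cons (fun a => enc_bundle name [:: a])) -catA => E1.
have [l1 [f1 [it [E2 C1 Eit Hit]]]] := chunk_bundle f o0 E1.
have [l' [f' [I [El' C2 EI HI]]]] := IH l1 f1 E2.
exists l', f', (it :: I); split=> //.
- have := chunk_trans C1 C2.
  by rewrite /=; case: (it_mark it).
- by rewrite /= EI Eit.
exact: (@good_cat [:: it]).
Qed.

Definition enc_player (pl : seq Res * seq Res) : seq symbol :=
  enc_list [:: enc_bundle name pl.1; enc_bag name [seq [:: a] | a <- pl.2]].

Definition enc_atoms (s : seq Res) : seq symbol := enc_bag name [seq [:: a] | a <- s].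

Lemma enc_atomsE s r :
  enc_atoms s ++ r =
  Open :: flatten [seq enc_bundle name [:: a] | a <- s] ++ Close :: r.
Proof. by rewrite /enc_atoms /enc_bag /enc_list -map_comp cat_cons -catA. Qed.

Lemma enc_playerE g e r :
  enc_player (g, e) ++ r =
  [:: Open, Open & flatten (map (enc_res name) g) ++
    [:: Close, Open & flatten [seq enc_bundle name [:: a] | a <- e] ++
      [:: Close, Close & r]]].
Proof.
have -> : enc_player (g, e) = Open :: enc_bundle name g ++ enc_atoms e ++ [:: Close].
  by rewrite /enc_player {1}/enc_list flatten2 -catA.
by rewrite cat_cons -!catA cat1s enc_atomsE /enc_bundle {1}/enc_list cat_cons -catA.
Qed.

Lemma chunk_player o f l g e r :
  unzip1 l = enc_player (g, e) ++ r ->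
  exists l' f' I J, [/\ unzip1 l' = r,
    chunk P3 o f l (enc_atoms (mask (map it_mark J) e)) (I ++ J) P3 o.+1 f' l',
    map inst I = [seq (false, o.+1, name a) | a <- g],
    map inst J = [seq (true, o.+1, name a) | a <- e] & good (I ++ J)].
Proof.
rewrite enc_playerE; case: l => [|[s1 p1] [|[s2 p2] l]] //= [-> -> E1].
have [l1 [f1 [I [E2 C1 EI HI]]]] := @chunk_goal o.+1 f _ _ _ isT E1.
case: l1 E2 C1 => [|[s3 p3] [|[s4 p4] l1]] //= [-> -> E2] C1.
have [l2 [f2 [J [E3 C2 EJ HJ]]]] := @chunk_bundles o.+1 f1 _ _ _ isT E2.
case: l2 E3 C2 => [|[s5 p5] [|[s6 p6] l2]] //= [-> -> E3] C2.
exists l2, f2, I, J; split=> //; last exact: good_cat.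
have /= D1 := @chunk_step P3 o f Open p1 ((Open, p2) :: l) isT isT.
have /= D2 := @chunk_step Q0 o.+1 f Open p2 l isT isT.
have /= D3 := @chunk_step G0 o.+1 f1 Close p3 ((Open, p4) :: l1) isT isT.
have /= D4 := @chunk_step Q1 o.+1 f1 Open p4 l1 isT isT.
have /= D5 := @chunk_step B0 o.+1 f2 Close p5 ((Close, p6) :: l2) isT isT.
have /= D6 := @chunk_step Q2 o.+1 f2 Close p6 l2 isT isT.
rewrite addn1 in D1; rewrite !addn0 in D2 D3 D4 D5 D6.
have := chunk_trans D1 (chunk_trans D2 (chunk_trans C1 (chunk_trans D3
  (chunk_trans D4 (chunk_trans C2 (chunk_trans D5 D6)))))).
by rewrite !cats0 !cat0s cat1s -enc_atomsE cats0.
Qed.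

Hypothesis name_inj : injective name.

Definition cntI (e : bool) (o : nat) (k : seq bool) (I : seq item) : nat :=
  count (fun it => inst it == (e, o, k)) I.

Definition cntM (o : nat) (k : seq bool) (I : seq item) : nat :=
  count (fun it => (inst it == (true, o, k)) && it_mark it) I.

Lemma cntI_names e o I s a :
  map inst I = [seq (e, o, name b) | b <- s] ->
  cntI e o (name a) I = count_mem a s.
Proof.
move=> E; rewrite /cntI -(count_map inst (pred1 (e, o, name a))) E count_map.
apply: eq_count => b /=.
by rewrite xpair_eqE eqxx (inj_eq name_inj).
Qed.

Lemma cntM_names o I s a :
  map inst I = [seq (true, o, name b) | b <- s] ->
  cntM o (name a) I = count_mem a (mask (map it_mark I) s).
Proof.
elim: I s => [|it I IH] [|b s] // /eqP; rewrite !map_cons eqseq_cons.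
move=> /andP[/eqP Eit /eqP/IH E]; rewrite /cntM /= -/(cntM _ _ _) E Eit xpair_eqE eqxx (inj_eq name_inj) /=.
by case: (it_mark it); rewrite ?andbF ?andbT.
Qed.

Lemma cntI0 e e' o o' k I s :
  map inst I = [seq (e', o', name b) | b <- s] -> (e, o) != (e', o') ->
  cntI e o k I = 0.
Proof.
move=> E ne; rewrite /cntI -(count_map inst (pred1 (e, o, k))) E count_map.
rewrite (eq_count (a2 := pred0)) ?count_pred0 // => b /=.
by rewrite xpair_eqE eq_sym (negbTE ne).
Qed.

Lemma cntM_le o k I : cntM o k I <= cntI true o k I.
Proof. by apply: sub_count => it /andP[]. Qed.

Lemma cntI_own e o k I : all (fun it => o < it_own it) I -> cntI e o k I = 0.
Proof.
move=> H; rewrite /cntI; elim: I H => //= it I IH /andP[lt /IH ->].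
rewrite addn0; case: eqP => // -[_ E _].
by rewrite E ltnn in lt.
Qed.

Lemma cntI_cat e o k I J : cntI e o k (I ++ J) = cntI e o k I + cntI e o k J.
Proof. exact: count_cat. Qed.

Lemma cntM_cat o k I J : cntM o k (I ++ J) = cntM o k I + cntM o k J.
Proof. exact: count_cat. Qed.

Lemma cntM0 o k I : cntI true o k I = 0 -> cntM o k I = 0.
Proof. by move=> E; have := cntM_le o k I; rewrite E leqn0 => /eqP. Qed.

(** The bound [o < it_own it] separates players: the instances of later players do not contribute to
    the counts of the current one. *)
Lemma chunk_players o f l pl r :
  unzip1 l = flatten (map enc_player pl) ++ r ->
  exists l' f' I pss, [/\ unzip1 l' = r, size pss = size pl,
    chunk P3 o f l (flatten (map enc_atoms pss)) I P3 (o + size pl) f' l',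
    good I /\ all (fun it => o < it_own it) I
    & forall j a, j < size pl ->
      [/\ cntI false (o + j).+1 (name a) I = count_mem a (nth ([::], [::]) pl j).1,
          cntI true (o + j).+1 (name a) I = count_mem a (nth ([::], [::]) pl j).2
        & cntM (o + j).+1 (name a) I = count_mem a (nth [::] pss j)]].
Proof.
elim: pl l f o => [|[g e] pl IH] l f o.
  by move=> E; exists l, f, [::], [::]; split=> //; rewrite addn0.
rewrite flatten_map_cons -catA => E1.
have [l1 [f1 [I [J [E2 C1 EI EJ HIJ]]]]] := chunk_player o f E1.
have [l' [f' [K [pss [El' Esz C2 [HK oK] EK]]]]] := IH l1 f1 o.+1 E2.
exists l', f', ((I ++ J) ++ K), (mask (map it_mark J) e :: pss); split=> //=.
- by rewrite Esz.
- by rewrite addnS -addSn; exact: chunk_trans C1 C2.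
- split; first exact: good_cat.
  rewrite all_cat; apply/andP; split; last by apply: sub_all oK => it /ltnW.
  have : all (fun t => t.1.2 == o.+1) (map inst (I ++ J)).
    by rewrite map_cat EI EJ all_cat !all_map; apply/andP; split; apply/allP => a _ /=.
  by rewrite all_map; apply: sub_all => it /= /eqP <-.
case=> [|j] a lt_j; rewrite !cntI_cat !cntM_cat.
  rewrite addn0 (cntI_names a EI) (cntI_names a EJ) (cntM_names a EJ).
  have KF := cntI_own false (name a) oK; have KT := cntI_own true (name a) oK.
  have IT : cntI true o.+1 (name a) I = 0 by apply: cntI0 EI _; rewrite xpair_eqE.
  have JF : cntI false o.+1 (name a) J = 0 by apply: cntI0 EJ _; rewrite xpair_eqE.
  by rewrite KF KT IT JF (cntM0 KT) (cntM0 IT) !addn0.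
have [EF ET EM] := EK j a lt_j.
have Z0 e1 e2 H s : map inst H = [seq (e2, o.+1, name b) | b <- s] ->
    cntI e1 (o.+1 + j).+1 (name a) H = 0.
  by move=> EH; apply: cntI0 EH _; rewrite xpair_eqE; case: eqP => //=; lia.
rewrite -addSnnS EF ET EM !(Z0 _ _ _ _ EI) !(Z0 _ _ _ _ EJ).
by rewrite (cntM0 (Z0 _ _ _ _ EI)) (cntM0 (Z0 _ _ _ _ EJ)).
Qed.

Definition enc_game (types : seq Res) (pl : seq (seq Res * seq Res)) : seq symbol :=
  enc_list [:: enc_bundle name types; enc_list (map enc_player pl)].

Lemma chunk_game f l types pl :
  unzip1 l = enc_game types pl ->
  exists I pss, [/\ size pss = size pl,
    (emission z P0 f l).1 = enc_list (map enc_atoms pss),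
    items P0 0 l = I /\ nb_players P0 l = size pl, good I
    & forall j a, j < size pl ->
      [/\ cntI false j.+1 (name a) I = count_mem a (nth ([::], [::]) pl j).1,
          cntI true j.+1 (name a) I = count_mem a (nth ([::], [::]) pl j).2
        & cntM j.+1 (name a) I = count_mem a (nth [::] pss j)]].
Proof.
have -> : enc_game types pl = [:: Open, Open & flatten (map (enc_res name) types) ++
    [:: Close, Open & flatten (map enc_player pl) ++ [:: Close; Close]]].
  have E : enc_game types pl =
      Open :: (enc_bundle name types ++ enc_list (map enc_player pl)) ++ [:: Close].
    by rewrite /enc_game {1}/enc_list flatten2.
  by rewrite E /enc_bundle /enc_list -!catA !cat_cons -!catA.
case: l => [|[s1 p1] [|[s2 p2] l]] //= [-> -> E1].
have [l1 [f1 [E2 C1]]] := chunk_types 0 f E1.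
case: l1 E2 C1 => [|[s3 p3] [|[s4 p4] l1]] //= [-> -> E2] C1.
have [l2 [f2 [I [pss [E3 Esz C2 [HI _] EI]]]]] := chunk_players 0 f1 E2.
case: l2 E3 C2 => [|[s5 p5] [|[s6 p6] l2]] //= [-> -> E3] C2.
case: l2 E3 C2 => // _ C2; rewrite add0n in C2.
have /= D1 := @chunk_step P0 0 f Open p1 ((Open, p2) :: l) isT isT.
have /= D2 := @chunk_step P1 0 f Open p2 l isT isT.
have /= D3 := @chunk_step T0 0 f1 Close p3 ((Open, p4) :: l1) isT isT.
have /= D4 := @chunk_step P2 0 f1 Open p4 l1 isT isT.
have /= D5 := @chunk_step P3 (size pl) f2 Close p5 [:: (Close, p6)] isT isT.
have /= D6 := @chunk_step PE (size pl) f2 Close p6 [::] isT isT.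
rewrite !addn0 in D1 D2 D3 D4 D5 D6.
have [F1 F2 F3] := chunk_trans D1 (chunk_trans D2 (chunk_trans C1 (chunk_trans D3
  (chunk_trans D4 (chunk_trans C2 (chunk_trans D5 D6)))))).
exists I, pss; split=> //.
- by move: F1; rewrite /= !cats0.
- by split; [move: F2; rewrite /= !cats0 | move: F3; rewrite /= !addn0 ?add0n].
Qed.

End Encodings.

Section Atoms.

Local Open Scope mset_scope.

Variable Res : choiceType.

Definition atoms_bag (s : seq Res) : {mset {mset Res}} :=
  seq_mset [seq (seq_mset B : {mset Res}) | B <- [seq [:: a] | a <- s]].

Lemma seq_mset1 (a : Res) : seq_mset [:: a] = [mset a]%mset.
Proof. by apply/msetP => b; rewrite mset_seqE msetnE /= addn0 eq_sym; case: eqP. Qed.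

Lemma atoms_bagE s : atoms_bag s = singles s.
Proof.
by rewrite /atoms_bag -map_comp; congr seq_mset; apply: eq_map => a /=; exact: seq_mset1.
Qed.

(** A listing of a singleton multiset is unique, so every encoded bundle of an endowment has the
    shape that the automaton expects. *)
Lemma atomic_listing (ss : seq (seq Res)) :
  atomic (seq_mset [seq (seq_mset B : {mset Res}) | B <- ss]) ->
  ss = [seq [:: a] | a <- flatten ss].
Proof.
move=> H; have {}H B : B \in ss -> exists a, B = [:: a].
  move=> Bss; have [|a Ea] := H (seq_mset B).
    by rewrite -mset_gt0 mset_seqE -has_count has_pred1; exact: map_f.
  exists a; apply: perm_small_eq => //; apply/eq_seq_msetP.
  by rewrite Ea seq_mset1.
elim: ss H => //= B ss IH H; have [|a ->] := H B; first exact: mem_head.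
rewrite /= -IH // => C Css; apply: H.
by rewrite inE Css orbT.
Qed.

End Atoms.

(** * From the encoding to the hypotheses of the search, and the result *)

Section Assembly.

Variables (Res : finType) (name : Res -> seq bool) (G : rcg Res).
Variables (types : seq Res) (gs ea : 'I_(nplayers G) -> seq Res).

Hypothesis name_inj : injective name.
Hypothesis G_bar : rcgbar G.
Hypothesis gsE : forall i, seq_mset (gs i) = goal i.
Hypothesis eaE : forall i, atoms_bag (ea i) = endowment i.

Local Notation n := (nplayers G).

Definition players_list := [seq (gs i, ea i) | i <- enum 'I_n].

Let w := enc_game name types players_list.
Local Notation L := (size w).

Lemma size_players : size players_list = n.
Proof. by rewrite size_map size_enum_ord. Qed.

Lemma nth_players (i : 'I_n) : nth ([::], [::]) players_list i = (gs i, ea i).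
Proof. by rewrite (nth_map i) ?size_enum_ord // nth_ord_enum. Qed.

Lemma behead_drop (T : Type) x (u : seq T) : behead (drop x u) = drop x.+1 u.
Proof. by rewrite -drop1 drop_drop add1n. Qed.

Lemma inst_pos P x : inst (pos_item w P x) = (isEx w x, own w x, key w x).
Proof. by rewrite /inst /it_key /= behead_drop. Qed.

Definition positions := [seq x <- iota 0 L | isGx w x || isEx w x].

Lemma isEG x : isEx w x -> isGx w x = false.
Proof. by rewrite /isEx /isGx; case: (phs w x). Qed.

Lemma cntI_pos P e o k :
  cntI e o k [seq pos_item w P x | x <- positions] =
  cnt w (fun x => (if e then isEx w x else isGx w x) && (own w x == o)) L k.
Proof.
rewrite /cntI count_map count_filter; apply: eq_count => x /=.
rewrite inst_pos !xpair_eqE; have := @isEG x; case: e; case: (isEx w x) => //=.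
- by rewrite orbT andbT.
- by move=> ->.
by rewrite orbF andbC andbA.
Qed.

Lemma cntM_pos (P : pred nat) o k :
  (forall x, x < L -> P x -> isEx w x) ->
  cntM o k [seq pos_item w P x | x <- positions] =
  cnt w (fun x => P x && (own w x == o)) L k.
Proof.
move=> sPE; rewrite /cntM count_map count_filter; apply: eq_in_count => x.
rewrite mem_iota /= add0n => lt_x; rewrite inst_pos !xpair_eqE.
have := sPE x lt_x; case: (P x); last by rewrite andbF.
by move=> ->; rewrite // orbT !andbT.
Qed.

(** Instantiated with [pred0] for facts about the input alone, and with the final marks for the
    output. *)
Lemma structure (P : pred nat) z f :
  let I := [seq pos_item w P x | x <- positions] in
  exists pss, [/\ size pss = n,
    (emission z P0 f (marked w P 0)).1 = enc_list (map (enc_atoms name) pss),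
    count (isPx w) (iota 0 L) = n, good name I
    & forall (j : 'I_n) a,
      [/\ cntI false j.+1 (name a) I = count_mem a (gs j),
          cntI true j.+1 (name a) I = count_mem a (ea j)
        & cntM j.+1 (name a) I = count_mem a (nth [::] pss j)]].
Proof.
move=> I; have [|I' [pss [Esz Eem [EI EnP] HI EC]]] :=
  @chunk_game Res name z name_inj f (marked w P 0) types players_list.
  by rewrite unzip1_marked drop0.
have := items_marked P (leq0n L); rewrite phs0 subn0 -/positions -/I => E.
have := nP_marked P (leq0n L); rewrite phs0 add0n EnP size_players => En.
rewrite -EI {}E in HI EC.
exists pss; split; [by rewrite Esz size_players | exact: Eem | by [] | exact: HI |].
by move=> j a; have := EC j a; rewrite nth_players size_players; apply.
Qed.

Lemma own_le_n x : x < L -> own w x <= n.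
Proof.
have [pss [_ _ En _ _]] := structure pred0 false false.
by move=> lt_x; rewrite -[X in _ <= X]En -(subnKC lt_x) iotaD count_cat leq_addr.
Qed.

(** Each player owns the position where it starts, and position 0 starts none. *)
Lemma n_lt : n < L.
Proof.
have [pss [_ _ En _ _]] := structure pred0 false false.
have L0 : 0 < L by [].
have E : iota 0 L = 0 :: iota 1 L.-1 by rewrite -[in LHS](prednK L0).
have P0F : isPx w 0 = false by rewrite isPxE phs0.
have E' : count (isPx w) (0 :: iota 1 L.-1) = isPx w 0 + count (isPx w) (iota 1 L.-1) by [].
rewrite -En E {}E' P0F add0n.
have := count_size (isPx w) (iota 1 L.-1); rewrite size_iota.
by rewrite -ltnS (prednK L0).
Qed.

Lemma inst_wf_pos x : x < L -> isGx w x || isEx w x ->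
  [/\ wf_inst w x, 0 < own w x & exists a, key w x = name a].
Proof.
have [pss [_ _ _ HI _]] := structure pred0 false false.
move=> lt_x lab; have /= [|o0 [r [a Ea]]] := HI (own w x, drop x w).
  rewrite -map_comp; apply/mapP; exists x => //.
  by rewrite mem_filter lab mem_iota.
have Ek : key w x = name a by rewrite /key -behead_drop Ea /= bits_of_map.
by split=> //; [exists r; rewrite Ek | exists a].
Qed.

Lemma goal_cnt (i : 'I_n) a :
  goal i a = cnt w (fun x => isGx w x && (own w x == i.+1)) L (name a).
Proof.
have [pss [_ _ _ _ EC]] := structure pred0 false false.
by have [E _ _] := EC i a; rewrite -gsE mset_seqE -E (cntI_pos _ false).
Qed.

Lemma endowment_cnt (i : 'I_n) a :
  eps_flat i a = cnt w (fun x => isEx w x && (own w x == i.+1)) L (name a).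
Proof.
have [pss [_ _ _ _ EC]] := structure pred0 false false.
by have [_ E _] := EC i a; rewrite /eps_flat -eaE atoms_bagE flat_singles -E (cntI_pos _ true).
Qed.

Lemma main_correct :
  exists P : profile G,
    encodes_profile name
      (out (exec L main_prog (fun=> 0) (init_store 6 ini (ini Open) flags0 w))) P /\
    NE_pca P.
Proof.
set s0 := init_store _ _ _ _ _.
have CI0 : search_inv name (@goal _ G) (@eps_flat _ G) w set0 n.+1 (exec L parse (fun=> 0) s0).
  apply: parse_correct => //; [exact: own_le_n|].
  move=> i x lt_x; rewrite -[LHS]/(nth (ini Open) (map ini w) x).
  by rewrite (nth_map Close).
have [b [U [c [P [f [Hs f_inv [sPE Ef]]]]]]] := search_correct own_le_n inst_wf_pos
  goal_cnt endowment_cnt n_lt (h := fun=> 0) (erefl _) (erefl _)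
  (ex_intro (fun b => search_inv _ _ _ _ _ b _) _ CI0).
have [z [f9 Eout]] := exec_emit (h := fun=> 0) (erefl _) (erefl _) Hs.
have [pss [Esz Eem _ _ EC]] := structure P z f9.
pose Pp : profile G := [ffun i : 'I_n => atoms_bag (nth [::] pss i)].
have EPp (i : 'I_n) : f i = flats Pp i.
  apply/msetP => a; rewrite Ef /flats ffunE atoms_bagE flat_singles.
  by have [_ _ <-] := EC i a; rewrite cntM_pos.
exists Pp; split.
  exists (fun i : 'I_n => [seq [:: a] | a <- nth [::] pss i]); split.
    by move=> i; rewrite /lists_bag ffunE.
  have -> : exec L main_prog (fun=> 0) s0 =
    exec L emit_prog (fun=> 0) (exec L search_prog (fun=> 0) (exec L parse (fun=> 0) s0)) by [].
  rewrite Eout Eem; congr enc_list.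
  rewrite -[in LHS](mkseq_nth [::] pss) Esz /mkseq -map_comp -val_enum_ord -map_comp.
  exact: eq_map.
have {}f_inv := stage_ext EPp f_inv.
apply: (stage_NE G_bar n_lt _ f_inv); last by move=> b' lt_b; apply: final_stable n_lt _ lt_b.
move=> i; rewrite /is_choice -flat_bag_sub; last exact: G_bar.
  by case: f_inv => _ _ _ /(_ i).
by rewrite ffunE atoms_bagE; exact: singles_atomic.
Qed.

End Assembly.

Theorem theorem5 :
  (forall (Res : choiceType) (G : rcg Res),
     rcgbar G -> exists P : profile G, NE_pca P) /\
  (exists (M : tm symbol) (p : {poly nat}),
     forall (Res : finType) (name : Res -> seq bool) (G : rcg Res)
            (w : seq symbol),
       injective name -> rcgbar G -> encodes_game name w G ->
       exists (t : nat) (v : seq symbol) (P : profile G),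
         [/\ (t <= p.[size w]%R)%N, tm_computes M w t v,
             encodes_profile name v P & NE_pca P]).
Proof.
split=> [Res G G_bar|]; first exact: NE_exists.
exists (machine ini flags0 main_prog), (cost main_prog + 2%:P * 'X + 4%:P)%R.
move=> Res name G w name_inj G_bar [types [gs [es [_ Hg He Ew]]]].
have [t le_t Ht] := machine_correct ini (ini Open) flags0 w main_prog_wf.
have Ees i : es i = [seq [:: a] | a <- flatten (es i)].
  by apply: atomic_listing; rewrite (He i : _ = _); exact: G_bar.
have Eea i : atoms_bag (flatten (es i)) = endowment i.
  by rewrite /atoms_bag -Ees; exact: He.
have Ew' : w = enc_game name types (players_list gs (fun i => flatten (es i))).
  rewrite Ew /enc_game /players_list -map_comp; congr (enc_list [:: _; enc_list _]).
  by apply: eq_map => i /=; rewrite /enc_player /= -Ees.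
have [P [HP NE_P]] := main_correct types name_inj G_bar Hg Eea.
rewrite -Ew' in HP.
by exists t, (out (exec (size w) main_prog (fun=> 0) (init_store 6 ini (ini Open) flags0 w))), P.
Qed.
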